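(* Let $(R,m_R)$ be a Noetherian local ring of dimension $d$ and let $I_1,\dots,I_r$ be ideals of $R$ such that the analytic spread $\ell(I_1\cdots I_r)=d$. Suppose there exists a numerical polynomial $F\in\mathbb{Q}[n_1,\dots,n_r]$ such that $$l_R\left(H^0_{m_R}\left(\frac{R}{I_1^{n_1}\cdots I_r^{n_r}}\right)\right)\le F(n_1,\dots,n_r)$$ for all $n_1,\dots,n_r\gg0$. Then the total degree of $F$ is at least $d$.
   Context: The analytic spread $\ell(I)$ of an ideal $I$ of a Noetherian local ring $(R,m_R)$ is the Krull dimension of $\bigoplus_{n\ge0}I^n/m_RI^n$. $H^0_{m_R}(N)$ is the submodule of elements of $N$ annihilated by a power of $m_R$. A numerical polynomial is a rational polynomial taking integer values at integer points.
   Formalization: The product I_1⋯I_r is additionally assumed to be a proper ideal; without this the claim fails, e.g. for a discrete valuation ring with r = 1, I_1 = R, d = 1, where the analytic spread is 1, all lengths are 0 and F = 0 is allowed. *)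

(* Defs.v *)
From HB Require Import structures.
From mathcomp Require Import all_boot all_order all_algebra.
From mathcomp Require Import mpoly.
Set Implicit Arguments. Unset Strict Implicit. Unset Printing Implicit Defensive.
Import Order.TTheory GRing.Theory Num.Theory.
Local Open Scope ring_scope.

Definition subsetP' (A : Type) (P Q : A -> Prop) := forall x, P x -> Q x.
Definition ssubset (A : Type) (P Q : A -> Prop) :=
  subsetP' P Q /\ exists x, Q x /\ ~ P x.

Definition prime_chain (A : Type) (Prime : (A -> Prop) -> Prop)
  (k : nat) (c : nat -> A -> Prop) :=
  (forall i, (i <= k)%N -> Prime (c i)) /\
  (forall i, (i < k)%N -> ssubset (c i) (c i.+1)).

Definition krull_dim_eq (A : Type) (Prime : (A -> Prop) -> Prop) (d : nat) :=
  (exists c, prime_chain Prime d c) /\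
  (forall k c, prime_chain Prime k c -> (k <= d)%N).

Section Ideals.
Variable R : comRingType.

Definition is_ideal (I : R -> Prop) :=
  I 0 /\ (forall x y, I x -> I y -> I (x + y)) /\ (forall a x, I x -> I (a * x)).

Definition is_prime (P : R -> Prop) :=
  is_ideal P /\ ~ P 1 /\ (forall x y, P (x * y) -> P x \/ P y).

Definition is_maximal (M : R -> Prop) :=
  is_ideal M /\ ~ M 1 /\
  (forall J, is_ideal J -> subsetP' M J -> ~ J 1 -> subsetP' J M).

Definition is_local (m : R -> Prop) :=
  is_maximal m /\ (forall J, is_ideal J -> ~ J 1 -> subsetP' J m).

Definition noetherian :=
  forall f : nat -> R -> Prop, (forall n, is_ideal (f n)) ->
    (forall n, subsetP' (f n) (f n.+1)) ->
    exists N, forall n, (N <= n)%N -> subsetP' (f n) (f N).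

Definition idl_mul (J K : R -> Prop) : R -> Prop := fun x =>
  exists s : seq (R * R), (forall p, p \in s -> J p.1 /\ K p.2) /\
    x = \sum_(p <- s) p.1 * p.2.

Fixpoint idl_pow (J : R -> Prop) (n : nat) : R -> Prop :=
  match n with
  | 0 => fun _ => True
  | n.+1 => idl_mul (idl_pow J n) J
  end.

Definition idl_prod (r : nat) (f : 'I_r -> R -> Prop) : R -> Prop :=
  foldr (fun i acc => idl_mul (f i) acc) (fun _ => True) (enum 'I_r).

(* Saturation J : m^oo, so that H^0_m(R/J) = (J : m^oo) / J. *)
Definition idl_sat (m J : R -> Prop) : R -> Prop := fun x =>
  exists k, forall y, idl_pow m k y -> J (x * y).

(* l_R(N/J) <= b for ideals J <= N: every strict chain of R-submodules of
   N/J, i.e. of ideals J <= K_0 < K_1 < ... < K_k <= N, has k <= b. *)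
Definition length_le (J N : R -> Prop) (b : rat) :=
  forall (k : nat) (K : nat -> R -> Prop),
    (forall i, (i <= k)%N -> is_ideal (K i) /\ subsetP' J (K i) /\ subsetP' (K i) N) ->
    (forall i, (i < k)%N -> ssubset (K i) (K i.+1)) ->
    k%:R <= b.

Definition dim_eq (d : nat) := krull_dim_eq is_prime d.

(* The fiber cone F(I) = (+)_n I^n / m I^n.  Elements are represented by
   finitely supported sequences a with a n in I^n, modulo the relation
   a ~ b iff a n - b n in m I^n for all n; multiplication is the Cauchy
   product.  Prime ideals of F(I) correspond to the sets P below. *)
Section FiberCone.
Variables (m I : R -> Prop).

Definition fc_elem (a : nat -> R) :=
  (exists N, forall n, (N <= n)%N -> a n = 0) /\ (forall n, idl_pow I n (a n)).
Definition fc_equiv (a b : nat -> R) :=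
  forall n, idl_mul m (idl_pow I n) (a n - b n).
Definition fc_add (a b : nat -> R) : nat -> R := fun n => a n + b n.
Definition fc_mul (a b : nat -> R) : nat -> R :=
  fun n => \sum_(i < n.+1) a i * b (n - i)%N.
Definition fc_one : nat -> R := fun n => (n == 0)%:R.
Definition fc_zero : nat -> R := fun _ => 0.

Definition fc_prime (P : (nat -> R) -> Prop) :=
  subsetP' P fc_elem /\
  (forall a, fc_elem a -> fc_equiv a fc_zero -> P a) /\
  (forall a b, P a -> fc_elem b -> fc_equiv a b -> P b) /\
  (forall a b, P a -> P b -> P (fc_add a b)) /\
  (forall a b, fc_elem a -> P b -> P (fc_mul a b)) /\
  ~ P fc_one /\
  (forall a b, fc_elem a -> fc_elem b -> P (fc_mul a b) -> P a \/ P b).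

Definition analytic_spread_eq (d : nat) := krull_dim_eq fc_prime d.
End FiberCone.

End Ideals.

Definition numerical_poly (r : nat) (F : {mpoly rat[r]}) :=
  forall n : 'I_r -> int, exists z : int, F.@[fun i => (n i)%:~R] = z%:~R.

(* Main.v *)
Require Import Defs.
From HB Require Import structures.
From mathcomp Require Import all_boot all_order all_algebra.
From mathcomp Require Import mpoly ring zify.
From Stdlib Require Import Classical ClassicalEpsilon.
From Stdlib Require Import FunctionalExtensionality PropExtensionality.
Set Implicit Arguments. Unset Strict Implicit. Unset Printing Implicit Defensive.
Import Order.TTheory GRing.Theory Num.Theory.
Local Open Scope ring_scope.

(* With n_1 = ... = n_r = n and I = I_1 ... I_r one has to show that the length of
   H^0_m(R/I^n) is not O(n^(d-1)).  Let Q be the homogeneous part of the bottom prime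
   of a chain of d + 1 primes in the fiber cone.  Multiplying by an element of a bigger
   prime raises the degree of growth by one, so the sum over s <= n of l(I^s/Q_s) grows
   at least like n^d.
   Either some z in I^e outside Q satisfies m^k z <= I^(e+1), or some f in m is such
   that f^k z in I^(s+1) forces z in Q_s (otherwise the product of the counterexamples
   for generators f of m is such a z).
   In the first case z^j I^b is contained in the saturation of I^n for n = (e+1)j + b
   and contributes l(I^b/Q_b) in degree n - j, so l(H^0_m(R/I^n)) grows like n^d.
   In the second case the filtration by the ideals f^a I^s together with two uniform
   Artin-Rees estimates gives l(R/m^N) >= c N^(d+1), against dim R = d. *)

(** The dichotomy reflects the equality dim G = dim R for the associated graded ring G of I. Pulled
    back to G, the prime Q has a quotient of dimension at least d, so it has to be minimal, and
    every f in m must become nilpotent in G localized at Q. An f as in the second case is not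
    nilpotent there. The contradiction is reached by counting: n powers of f, each contributing the
    growth n^d of G/Q, are fitted into R/m^N with N linear in n. This is why the Artin-Rees
    constants must not depend on s: a fixed loss for each power of I and for each power of f, at
    most n of either, keeps N of order n. Lengths enter only through bounds, from below by explicit
    chains and from above by a system of parameters, so all comparisons are between orders of growth
    up to a constant factor. *)

Lemma pred_ext (A : Type) (P Q : A -> Prop) :
  subsetP' P Q -> subsetP' Q P -> P = Q.
Proof.
move=> PQ QP; apply: functional_extensionality => x.
by apply: propositional_extensionality; split; [apply: PQ | apply: QP].
Qed.

Lemma not_subset (A : Type) (P Q : A -> Prop) :
  ~ subsetP' P Q -> exists2 x, P x & ~ Q x.
Proof.
move=> nPQ; apply: NNPP => nex; apply: nPQ => x Px.
by apply: NNPP => nQx; apply: nex; exists x.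
Qed.

Lemma leq_expl a b k : (a <= b)%N -> (a ^ k <= b ^ k)%N.
Proof. by case: k => // k ab; rewrite leq_exp2r. Qed.

(** Cancelling [n ^ d] leaves [n <= A * B ^ d]. Both cases end in this clash between growth of
    degree d + 1 and of degree d. *)
Lemma expn_growth_absurd n0 A B d :
  ~ (forall n, (n0 <= n)%N -> (0 < n)%N -> (n * n ^ d <= A * (B * n) ^ d)%N).
Proof.
move=> h; have := h (n0 + A * B ^ d).+1 (leqW (leq_addr _ _)) isT.
by rewrite expnMn mulnA leq_pmul2r ?expn_gt0 // leqNgt ltnS leq_addl.
Qed.

(** * Ideals *)

Section IdealArithmetic.
Variable R : comRingType.
Implicit Types J K L : R -> Prop.

Lemma idl0 J : is_ideal J -> J 0. Proof. by case. Qed.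
Lemma idlD J x y : is_ideal J -> J x -> J y -> J (x + y).
Proof. by case=> _ [hD _]; apply: hD. Qed.
Lemma idlM J a x : is_ideal J -> J x -> J (a * x).
Proof. by case=> _ [_ hM]; apply: hM. Qed.
Lemma idlMr J x a : is_ideal J -> J x -> J (x * a).
Proof. by rewrite mulrC; apply: idlM. Qed.
Lemma idlN J x : is_ideal J -> J x -> J (- x).
Proof. by move=> hJ Jx; rewrite -mulN1r; apply: idlM. Qed.
Lemma idlB J x y : is_ideal J -> J x -> J y -> J (x - y).
Proof. by move=> hJ Jx Jy; apply: idlD => //; apply: idlN. Qed.
Lemma idl_sum J (T : eqType) (s : seq T) (F : T -> R) :
  is_ideal J -> (forall i, i \in s -> J (F i)) -> J (\sum_(i <- s) F i).
Proof.
move=> hJ hF; rewrite big_seq_cond; apply: (big_ind J).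
- exact: idl0.
- by move=> x y; apply: idlD.
- by move=> i /andP[/hF].
Qed.

Lemma idl_eqT J : is_ideal J -> J 1 -> J = (fun _ => True).
Proof. by move=> hJ J1; apply: pred_ext => // x _; rewrite -[x]mulr1; apply: idlM. Qed.

Lemma idl_mulI J K x y : J x -> K y -> idl_mul J K (x * y).
Proof.
move=> Jx Ky; exists [:: (x, y)]; split; last by rewrite big_seq1.
by move=> p; rewrite inE => /eqP->.
Qed.

Lemma idl_mul0 J K : idl_mul J K 0.
Proof. by exists [::]; rewrite big_nil. Qed.

Lemma idl_mulD J K x y : idl_mul J K x -> idl_mul J K y -> idl_mul J K (x + y).
Proof.
move=> [s [hs ->]] [t [ht ->]]; exists (s ++ t); rewrite big_cat; split => // p.
by rewrite mem_cat => /orP[/hs|/ht].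
Qed.

(** Induction principle for elements of a product of ideals. Typically [L] is the preimage of an
    ideal under multiplication by a fixed element. *)
Lemma idl_mul_min J K L : L 0 -> (forall x y, L x -> L y -> L (x + y)) ->
  (forall x y, J x -> K y -> L (x * y)) -> subsetP' (idl_mul J K) L.
Proof.
move=> L0 LD h _ [s [hs ->]]; rewrite big_seq_cond; apply: (big_ind L) => //.
by move=> p /andP[/hs[Jp Kp] _]; apply: h.
Qed.

Lemma idl_mul_sub J K L : is_ideal L ->
  (forall x y, J x -> K y -> L (x * y)) -> subsetP' (idl_mul J K) L.
Proof. by case=> ? [? _]; apply: idl_mul_min. Qed.

Lemma idl_mulC J K : idl_mul J K = idl_mul K J.
Proof.
have sub J' K' : subsetP' (idl_mul J' K') (idl_mul K' J').
  apply: idl_mul_min; [exact: idl_mul0 | exact: idl_mulD | move=> x y Jx Ky].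
  by rewrite mulrC; apply: idl_mulI.
exact: pred_ext.
Qed.

Lemma idl_mulA J K L : idl_mul J (idl_mul K L) = idl_mul (idl_mul J K) L.
Proof.
apply: pred_ext.
- apply: idl_mul_min; [exact: idl_mul0 | exact: idl_mulD | move=> x y Jx].
  apply: (idl_mul_min (L := fun y => idl_mul (idl_mul J K) L (x * y))).
  + by rewrite mulr0; exact: idl_mul0.
  + by move=> u v; rewrite mulrDr; apply: idl_mulD.
  + by move=> u v Ku Lv; rewrite mulrA; apply: idl_mulI => //; apply: idl_mulI.
- apply: idl_mul_min; [exact: idl_mul0 | exact: idl_mulD | move=> x y JKx Ly].
  move: x JKx.
  apply: (idl_mul_min (L := fun x => idl_mul J (idl_mul K L) (x * y))).
  + by rewrite mul0r; exact: idl_mul0.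
  + by move=> u v; rewrite mulrDl; apply: idl_mulD.
  + by move=> u v Ku Lv; rewrite -mulrA; apply: idl_mulI => //; apply: idl_mulI.
Qed.

Lemma idl_mulCA J K L : idl_mul J (idl_mul K L) = idl_mul K (idl_mul J L).
Proof. by rewrite !idl_mulA (idl_mulC J). Qed.

Lemma idl_mulACA J K L M :
  idl_mul (idl_mul J K) (idl_mul L M) = idl_mul (idl_mul J L) (idl_mul K M).
Proof. by rewrite -!idl_mulA (idl_mulCA K). Qed.

Lemma idl_mul_ideal J K : is_ideal K -> is_ideal (idl_mul J K).
Proof.
move=> hK; split; [exact: idl_mul0 | split; first exact: idl_mulD].
move=> a; apply: (idl_mul_min (L := fun x => idl_mul J K (a * x))).
- by rewrite mulr0; exact: idl_mul0.
- by move=> u v; rewrite mulrDr; apply: idl_mulD.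
- by move=> x y Jx Ky; rewrite mulrCA; apply: idl_mulI => //; apply: idlM.
Qed.

Lemma idl_mulS J J' K K' : subsetP' J J' -> subsetP' K K' ->
  subsetP' (idl_mul J K) (idl_mul J' K').
Proof.
move=> sJ sK; apply: idl_mul_min; [exact: idl_mul0 | exact: idl_mulD | move=> x y Jx Ky].
by apply: idl_mulI; [apply: sJ | apply: sK].
Qed.

Lemma idl_mul1l J : is_ideal J -> idl_mul (fun _ => True) J = J.
Proof.
move=> hJ; apply: pred_ext; first by apply: idl_mul_sub => // x y _; apply: idlM.
by move=> x Jx; rewrite -[x]mul1r; apply: idl_mulI.
Qed.

Lemma idl_mul_subr J K : is_ideal K -> subsetP' (idl_mul J K) K.
Proof. by move=> hK; apply: idl_mul_sub => // x y _; apply: idlM. Qed.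

Lemma idl_mul_subl J K : is_ideal J -> subsetP' (idl_mul J K) J.
Proof. by move=> hJ; rewrite idl_mulC; apply: idl_mul_subr. Qed.

Lemma idl_pow_ideal J n : is_ideal J -> is_ideal (idl_pow J n).
Proof. by move=> hJ; case: n => [|n] //=; apply: idl_mul_ideal. Qed.

Lemma idl_powD J a b : is_ideal J ->
  idl_pow J (a + b) = idl_mul (idl_pow J a) (idl_pow J b).
Proof.
move=> hJ; elim: b => [|b IH].
  by rewrite addn0 idl_mulC idl_mul1l //; apply: idl_pow_ideal.
by rewrite addnS /= IH idl_mulA.
Qed.

Lemma idl_powDI J a b x y : is_ideal J ->
  idl_pow J a x -> idl_pow J b y -> idl_pow J (a + b) (x * y).
Proof. by move=> hJ Jx Jy; rewrite idl_powD //; apply: idl_mulI. Qed.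

Lemma idl_pow1 J : is_ideal J -> idl_pow J 1 = J.
Proof. exact: idl_mul1l. Qed.

Lemma idl_powX J e x j : is_ideal J -> idl_pow J e x -> idl_pow J (e * j) (x ^+ j).
Proof.
move=> hJ Jx; elim: j => [|j IH]; first by rewrite muln0.
by rewrite mulnS exprS; apply: idl_powDI.
Qed.

Lemma idl_powX1 J x j : is_ideal J -> J x -> idl_pow J j (x ^+ j).
Proof. by move=> hJ Jx; rewrite -{1}[j]mul1n; apply: idl_powX; rewrite ?idl_pow1. Qed.

Lemma idl_pow_dec J a b : is_ideal J -> (a <= b)%N ->
  subsetP' (idl_pow J b) (idl_pow J a).
Proof.
move=> hJ /subnKC<-; rewrite idl_powD // => x; apply: idl_mul_subl.
exact: idl_pow_ideal.
Qed.

Lemma idl_pow_mul J K n :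
  idl_pow (idl_mul J K) n = idl_mul (idl_pow J n) (idl_pow K n).
Proof.
elim: n => [|n IH] /=; first by rewrite idl_mul1l.
by rewrite IH idl_mulACA.
Qed.

(** With all exponents equal, the multigraded hypothesis becomes one about the powers of a single
    ideal. *)
Lemma idl_pow_prod r (J : 'I_r -> R -> Prop) n :
  idl_prod (fun i => idl_pow (J i) n) = idl_pow (idl_prod J) n.
Proof.
rewrite /idl_prod; elim: (enum 'I_r) => [|i s IH] /=; last by rewrite IH idl_pow_mul.
by elim: n => [|n IHn] //=; rewrite -IHn idl_mul1l.
Qed.

Lemma idl_prod_ideal r (J : 'I_r -> R -> Prop) : is_ideal (idl_prod J).
Proof. by rewrite /idl_prod; elim: (enum 'I_r) => [|i s IH] //=; apply: idl_mul_ideal. Qed.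

Lemma idlI J K : is_ideal J -> is_ideal K -> is_ideal (fun x => J x /\ K x).
Proof.
move=> hJ hK; split; first by split; apply: idl0.
split=> [x y [Jx Kx] [Jy Ky]|a x [Jx Kx]]; first by split; apply: idlD.
by split; apply: idlM.
Qed.

Definition idl_add J K : R -> Prop := fun x => exists u v, [/\ J u, K v & x = u + v].

Lemma idl_add_ideal J K : is_ideal J -> is_ideal K -> is_ideal (idl_add J K).
Proof.
move=> hJ hK; split; [|split].
- by exists 0, 0; rewrite addr0; split=> //; apply: idl0.
- move=> _ _ [u [v [Ju Kv ->]]] [u' [v' [Ju' Kv' ->]]].
  by exists (u + u'), (v + v'); rewrite addrACA; split=> //; apply: idlD.
- move=> a _ [u [v [Ju Kv ->]]].
  by exists (a * u), (a * v); rewrite mulrDr; split=> //; apply: idlM.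
Qed.

Lemma idl_addl J K : is_ideal K -> subsetP' J (idl_add J K).
Proof. by move=> hK x Jx; exists x, 0; rewrite addr0; split=> //; apply: idl0. Qed.
Lemma idl_addr J K : is_ideal J -> subsetP' K (idl_add J K).
Proof. by move=> hK x Jx; exists 0, x; rewrite add0r; split=> //; apply: idl0. Qed.
Lemma idl_add_sub J K L : is_ideal L -> subsetP' J L -> subsetP' K L ->
  subsetP' (idl_add J K) L.
Proof. by move=> hL JL KL _ [u [v [/JL Lu /KL Lv ->]]]; apply: idlD. Qed.

Definition idl_scale a J : R -> Prop := fun x => exists2 y, J y & x = a * y.

Lemma idl_scale_ideal a J : is_ideal J -> is_ideal (idl_scale a J).
Proof.
move=> hJ; split; [|split].
- by exists 0; rewrite ?mulr0 //; apply: idl0.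
- by move=> _ _ [u Ju ->] [v Jv ->]; exists (u + v); rewrite ?mulrDr //; apply: idlD.
- by move=> b _ [u Ju ->]; exists (b * u); [apply: idlM | rewrite mulrCA].
Qed.

Definition idl_adj J x : R -> Prop := idl_add J (idl_scale x (fun _ => True)).

Lemma idl_adj_ideal J x : is_ideal J -> is_ideal (idl_adj J x).
Proof. by move=> hJ; apply: idl_add_ideal => //; apply: idl_scale_ideal. Qed.
Lemma idl_adj_sub J x K : is_ideal K -> subsetP' J K -> K x -> subsetP' (idl_adj J x) K.
Proof. by move=> hK JK Kx; apply: idl_add_sub => // _ [y _ ->]; apply: idlMr. Qed.
Lemma idl_adjl J x : subsetP' J (idl_adj J x).
Proof. by apply: idl_addl; apply: idl_scale_ideal. Qed.
Lemma idl_adjr J x : is_ideal J -> idl_adj J x x.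
Proof. by move=> hJ; apply: idl_addr => //; exists 1; rewrite ?mulr1. Qed.
Lemma idl_adjC J x y : is_ideal J -> idl_adj (idl_adj J x) y = idl_adj (idl_adj J y) x.
Proof.
move=> hJ; have sub u v : subsetP' (idl_adj (idl_adj J u) v) (idl_adj (idl_adj J v) u).
  have hv := idl_adj_ideal v hJ; have huv := idl_adj_ideal u hv.
  apply: idl_adj_sub => //; last exact/idl_adjl/idl_adjr.
  apply: idl_adj_sub => //; last exact: idl_adjr.
  by move=> z Jz; do 2! apply: idl_adjl.
exact: pred_ext.
Qed.

Definition idl_gen J (s : seq R) : R -> Prop := foldr (fun x K => idl_adj K x) J s.

Lemma idl_gen_ideal J s : is_ideal J -> is_ideal (idl_gen J s).
Proof. by move=> hJ; elim: s => [|x s IH] //=; apply: idl_adj_ideal. Qed.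
Lemma idl_gen_adj J x s : is_ideal J -> idl_gen (idl_adj J x) s = idl_adj (idl_gen J s) x.
Proof.
by move=> hJ; elim: s => [|y s IH] //=; rewrite IH idl_adjC //; apply: idl_gen_ideal.
Qed.
Lemma idl_gen_sub J s K : is_ideal K -> subsetP' J K -> (forall x, x \in s -> K x) ->
  subsetP' (idl_gen J s) K.
Proof.
move=> hK JK; elim: s => [|x s IH] //= sK; apply: idl_adj_sub => //.
  by apply: IH => y ys; apply: sK; rewrite inE ys orbT.
by apply: sK; rewrite inE eqxx.
Qed.

Lemma idl_gen_base J s : subsetP' J (idl_gen J s).
Proof. by elim: s => [|x s IH] //= y Jy; apply/idl_adjl/IH. Qed.

Lemma idl_gen_mem J s x : is_ideal J -> x \in s -> idl_gen J s x.
Proof.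
move=> hJ; elim: s => [|y s IH] //=; rewrite inE => /orP[/eqP->|/IH]; last exact: idl_adjl.
by apply: idl_adjr; apply: idl_gen_ideal.
Qed.

Definition idl_zero : R -> Prop := fun x => x = 0.
Lemma idl_zero_ideal : is_ideal idl_zero.
Proof.
by split=> //; split=> [x y ->->|a x ->]; rewrite /idl_zero ?addr0 ?mulr0.
Qed.

(** Among [a + b] factors from K + (f), either [a] can be taken from K or [b] are multiples of f.
    The induction splits off the last factor: its part in K lowers [a], its multiple of f lowers
    [b]. *)
Lemma idl_pow_adj K f a b : is_ideal K -> subsetP' (idl_pow (idl_adj K f) (a + b)%N)
  (idl_add (idl_pow K a) (idl_scale (f ^+ b) (fun _ => True))).
Proof.
move=> hK.
have hT c : is_ideal (idl_scale (f ^+ c) (fun _ : R => True)) by apply: idl_scale_ideal.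
have hKa c : is_ideal (idl_pow K c) by apply: idl_pow_ideal.
have [n] := ubnP (a + b)%N; elim: n a b => // n IH [|a] [|b] nab.
- by move=> x _; apply: idl_addl.
- by move=> x _; apply: idl_addl.
- by move=> x _; apply: idl_addr => //; exists x; rewrite ?mul1r.
rewrite addSn; apply: idl_mul_sub; first exact: idl_add_ideal.
move=> p _ hp [u [_ [Ku [r _ ->] ->]]]; rewrite mulrDr.
apply: idlD; first exact: idl_add_ideal.
- have /IH : idl_pow (idl_adj K f) (a + b.+1)%N p by [].
  case=> [|v [_ [Kv [w _ ->] ->]]]; first lia.
  rewrite mulrDl; exists (v * u), (f ^+ b.+1 * (w * u)).
  by split; [apply: idl_mulI | exists (w * u) | rewrite mulrA].
- have /IH : idl_pow (idl_adj K f) (a.+1 + b)%N p by rewrite addSnnS.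
  case=> [|v [_ [Kv [w _ ->] ->]]]; first lia.
  rewrite mulrDl; exists (v * (f * r)), (f ^+ b.+1 * (w * r)); split.
  + exact: idlMr.
  + by exists (w * r).
  + by rewrite exprSr; congr (_ + _); ring.
Qed.

Lemma idl_sat_ideal m J : is_ideal m -> is_ideal J -> is_ideal (idl_sat m J).
Proof.
move=> hm hJ; split; first by exists 0%N => y _; rewrite mul0r; apply: idl0.
split=> [x y [k hk] [l hl]|a x [k hk]].
  exists (k + l)%N => w hw; rewrite mulrDl; apply: idlD => //.
    by apply: hk; apply: idl_pow_dec hw => //; apply: leq_addr.
  by apply: hl; apply: idl_pow_dec hw => //; apply: leq_addl.
by exists k => y /hk; rewrite -mulrA; apply: idlM.
Qed.

End IdealArithmetic.

(** * Maximal elements and finite generation in Noetherian rings *)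

Section Noetherian.
Variable R : comRingType.
Hypothesis hnoeth : noetherian R.
Implicit Types J K L : R -> Prop.

Lemma noetherian_max (C : (R -> Prop) -> Prop) J0 : C J0 ->
  (forall J, C J -> is_ideal J) ->
  exists J, [/\ C J & forall K, C K -> subsetP' J K -> subsetP' K J].
Proof.
move=> CJ0 Cid; apply: NNPP => nmax.
have next (J : {J | C J}) : {K : {K | C K} | ssubset (sval J) (sval K)}.
  apply: constructive_indefinite_description; apply: NNPP => nK; apply: nmax.
  exists (sval J); split=> [|K CK JK]; first exact: (svalP J).
  apply: NNPP => /not_subset[x Kx nJx]; apply: nK.
  by exists (exist _ K CK); split=> //; exists x.
pose f n := iter n (fun u => sval (next u)) (exist _ J0 CJ0).
have fS n : ssubset (sval (f n)) (sval (f n.+1)) by exact: (svalP (next (f n))).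
have [||N hN] := hnoeth (f := fun n => sval (f n)).
- by move=> n; apply/Cid/(svalP (f n)).
- by move=> n; case: (fS n).
by have [_ [x [fx nfx]]] := fS N; apply/nfx/(hN N.+1).
Qed.

Lemma noetherian_fg J : is_ideal J -> exists s, J = idl_gen (@idl_zero R) s.
Proof.
move=> hJ.
pose C K := subsetP' K J /\ exists s, K = idl_gen (@idl_zero R) s.
have zid := @idl_zero_ideal R.
have [||K [[KJ [s defK]] Kmax]] := @noetherian_max C (@idl_zero R).
- by split; [move=> x ->; apply: idl0 | exists [::]].
- by move=> K [_ [s ->]]; apply: idl_gen_ideal.
exists s; rewrite -defK; apply: pred_ext => // x Jx.
have hK : is_ideal K by rewrite defK; apply: idl_gen_ideal.
apply: (Kmax (idl_adj K x)); [| exact: idl_adjl | exact: idl_adjr].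
by split; [exact: idl_adj_sub | exists (x :: s); rewrite /= -defK].
Qed.

End Noetherian.

(** * Chains of submodules *)

Section Chains.
Variable R : comRingType.

Definition submod (V : lmodType R) (K : V -> Prop) :=
  K 0 /\ (forall x y, K x -> K y -> K (x + y)) /\ (forall a x, K x -> K (a *: x)).

(** Only the [k] steps above the bottom inclusion are strict. Peeling off the top step lets chains
    be transported by induction on [k] with [J] fixed. General modules are allowed because chains
    live both in R and in [{poly R}]. *)
Fixpoint chain (V : lmodType R) (J N : V -> Prop) (k : nat) : Prop :=
  match k with
  | 0 => subsetP' J N
  | k'.+1 => exists K, [/\ submod K, chain J K k' & ssubset K N]
  end.

Section SubmoduleTheory.
Variable V : lmodType R.
Implicit Types J K N P : V -> Prop.

Lemma submodB K x y : submod K -> K x -> K y -> K (x - y).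
Proof. by case=> _ [hD hZ] Kx Ky; apply: hD => //; rewrite -scaleN1r; apply: hZ. Qed.

Lemma submodI K N : submod K -> submod N -> submod (fun x => K x /\ N x).
Proof.
move=> [K0 [KD KZ]] [N0 [ND NZ]]; do 2! [split=> //].
  by move=> x y [? ?] [? ?]; split; [apply: KD | apply: ND].
by move=> a x [? ?]; split; [apply: KZ | apply: NZ].
Qed.

Lemma chain_sub J N k : chain J N k -> subsetP' J N.
Proof.
elim: k N => [|k IH] N //= [K [_ /IH JK [KN _]]] x Jx; exact/KN/JK.
Qed.

Lemma chain_le J J' N N' k :
  subsetP' J' J -> subsetP' N N' -> chain J N k -> chain J' N' k.
Proof.
move=> J'J; elim: k N N' => [|k IH] N N' NN' /=; first by move=> JN x /J'J/JN/NN'.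
case=> K [hK /IH JK [KN [x [Nx nKx]]]]; exists K; split=> //; first exact: JK.
by split=> [y /KN/NN'|] //; exists x; split=> //; apply: NN'.
Qed.

Lemma chain_cat J N P k l : chain J N k -> chain N P l -> chain J P (k + l).
Proof.
move=> JN; elim: l P => [|l IH] P /=; first by rewrite addn0 => NP; apply: chain_le JN.
by case=> K [hK /IH NK KP]; rewrite addnS; exists K.
Qed.

(** Subadditivity of length. By the modular law, a strict inclusion stays strict after intersecting
    with N or after adding N, so each step can be charged to one of the two chains. *)
Lemma chain_split J N P k : submod J -> submod N -> submod P ->
  subsetP' J N -> subsetP' N P -> chain J P k ->
  exists k1 k2, [/\ k = (k1 + k2)%N, chain J N k1 & chain N P k2].
Proof.
move=> hJ hN hP JN NP.
pose psi K := fun x : V => exists u v, [/\ K u, N v & x = u + v].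
have hpsi K : submod K -> submod (psi K).
  case=> K0 [KD KZ]; case: hN => N0 [ND NZ]; split; first by exists 0, 0; rewrite addr0.
  split=> [_ _ [u [v [Ku Nv ->]]] [u' [v' [Ku' Nv' ->]]]|a _ [u [v [Ku Nv ->]]]].
    by exists (u + u'), (v + v'); rewrite addrACA; split; auto.
  by exists (a *: u), (a *: v); rewrite scalerDr; split; auto.
suff main : chain J P k -> exists k1 k2,
    [/\ k = (k1 + k2)%N, chain J (fun x => P x /\ N x) k1 & chain N (psi P) k2].
  move=> /main[k1 [k2 [-> c1 c2]]]; exists k1, k2; split=> //.
    by apply: chain_le c1 => // x [].
  by apply: chain_le c2 => // _ [u [v [Pu /NP Pv ->]]]; case: hP => _ [hD _]; apply: hD.
move=> {NP}; elim: k P hP => [|k IH] P hP /=.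
  move=> JP; exists 0%N, 0%N; split=> // x xJ; first by split; auto.
  by exists 0, x; rewrite add0r; split=> //; case: hP.
case=> K [hK /(IH _ hK)[k1 [k2 [-> c1 c2]]] [KP [x [Px nKx]]]].
have [PNK|/not_subset[y [Py Ny] nKy]] := classic (subsetP' (fun y => P y /\ N y) K).
  exists k1, k2.+1; rewrite addnS; split=> //.
    by apply: chain_le c1 => // y [/KP].
  exists (psi K); split=> //; first exact: hpsi.
  split=> [_ [u [v [Ku Nv ->]]]|]; first by exists u, v; split; auto.
  exists x; split; first by exists x, 0; rewrite addr0; split=> //; case: hN.
  case=> u [v [Ku Nv defx]]; apply: nKx; rewrite defx.
  have [_ [KD _]] := hK; apply: KD => //; apply: PNK; split=> //.
  by have -> : v = x - u; [rewrite defx addrC addKr | apply: submodB => //; apply: KP].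
exists k1.+1, k2; rewrite addSn; split=> //.
  exists (fun x => K x /\ N x); split=> //; first exact: submodI.
  split=> [z [/KP]|] //; exists y; split=> //; by case.
apply: chain_le c2 => // _ [u [v [Ku Nv ->]]]; by exists u, v; split; auto.
Qed.

End SubmoduleTheory.

(** Each K is sent to h(K) + B. Steps remain strict because the kernel of N -> N'/B is contained in
    J, hence in every member of the chain. *)
Lemma chain_image (V V' : lmodType R) (h : {linear V -> V'}) (J N : V -> Prop)
    (B N' : V' -> Prop) k :
  submod N -> submod B -> submod N' -> subsetP' B N' ->
  (forall x, N x -> N' (h x)) -> (forall x, N x -> B (h x) -> J x) ->
  chain J N k -> chain B N' k.
Proof.
move=> hN hB hN' BN' hNN' hBJ.
pose phi K := fun y : V' => exists x b, [/\ K x, B b & y = h x + b].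
have hphi K : submod K -> submod (phi K).
  case=> K0 [KD KZ]; case: hB => B0 [BD BZ]; split.
    by exists 0, 0; rewrite linear0 addr0.
  split=> [_ _ [u [v [Ku Nv ->]]] [u' [v' [Ku' Nv' ->]]]|a _ [u [v [Ku Nv ->]]]].
    by exists (u + u'), (v + v'); rewrite linearD addrACA; split; auto.
  by exists (a *: u), (a *: v); rewrite linearZ scalerDr; split; auto.
suff main M : submod M -> subsetP' M N -> chain J M k -> chain B (phi M) k.
  move=> /(main _ hN (fun _ => id)); apply: chain_le => // _ [x [b [/hNN' Nx /BN' Nb ->]]].
  by case: hN' => _ [hD _]; apply: hD.
elim: k M => [|k IH] M hM MN /=.
  by move=> _ b Bb; exists 0, b; rewrite linear0 add0r; split=> //; case: hM.
case=> K [hK JK [KM [x [Mx nKx]]]]; exists (phi K); split; first exact: hphi.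
  by apply: IH => // y /KM/MN.
split=> [_ [y [b [Ky Bb ->]]]|]; first by exists y, b; split; auto.
exists (h x); split; first by exists x, 0; rewrite addr0; split=> //; case: hB.
case=> y [b [Ky Bb hx]]; apply: nKx; rewrite -[x](subrK y).
have [_ [KD _]] := hK; apply: KD => //; apply: (chain_sub JK); apply: hBJ.
  by apply: MN; apply: submodB => //; apply: KM.
by rewrite linearB hx addrC addKr.
Qed.

(** Since h is onto N modulo J, distinct members keep distinct preimages. This bounds the length of
    a cyclic module by that of R modulo an ideal killing its generator. *)
Lemma chain_preim (V V' : lmodType R) (h : {linear V -> V'}) (J N : V' -> Prop) k :
  submod N -> (forall y, N y -> exists x, J (y - h x)) ->
  chain J N k -> chain (fun x => J (h x)) (fun x => N (h x)) k.
Proof.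
move=> hN NJ; suff main M : submod M -> subsetP' M N ->
    chain J M k -> chain (fun x => J (h x)) (fun x => M (h x)) k by exact: main.
elim: k M => [|k IH] M hM MN /=; first by move=> JM x /JM.
case=> K [hK JK [KM [y [My nKy]]]]; exists (fun x => K (h x)); split.
- case: hK => K0 [KD KZ]; split; first by rewrite linear0.
  split=> [u v Ku Kv|a u Ku]; first by rewrite linearD; apply: KD.
  by rewrite linearZ; apply: KZ.
- by apply: IH => // z /KM/MN.
- split=> [x /KM|] //; have [x Jx] := NJ y (MN _ My).
  have Kyx := chain_sub JK Jx; exists x; split.
    by rewrite -[h x](subKr y); apply: submodB => //; apply: KM.
  move=> Khx; apply: nKy; rewrite -[y](subrK (h x)).
  by have [_ [KD _]] := hK; apply: KD.
Qed.

End Chains.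

(** * Lengths of quotients of ideals: lower bounds by chains, upper bounds by generators *)

Section Length.
Variable R : comRingType.
Implicit Types J K N a : R -> Prop.

Definition idl_chain J N k := @chain R R^o J N k.

Lemma idl_chain_mul x J N B N' k : is_ideal N -> is_ideal B -> is_ideal N' ->
  subsetP' B N' -> (forall y, N y -> N' (x * y)) ->
  (forall y, N y -> B (x * y) -> J y) -> idl_chain J N k -> idl_chain B N' k.
Proof.
move=> hN hB hN'.
have hlin : linear (fun y : R^o => x * y : R^o).
  by move=> b u v; rewrite mulrDr scalerAr.
pose h : {linear R^o -> R^o} := HB.pack (fun y : R^o => x * y : R^o)
  (GRing.isLinear.Build R R^o R^o *:%R _ hlin).
exact: (chain_image (h := h) (V := R^o) (V' := R^o) hN hB hN').
Qed.

Lemma length_le_chain J N b k : is_ideal J -> is_ideal N ->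
  length_le J N b -> idl_chain J N k -> k%:R <= b.
Proof.
move=> hJ hN hb; suff main : idl_chain J N k -> exists K : nat -> R -> Prop,
   [/\ forall i, (i <= k)%N -> is_ideal (K i) /\ subsetP' J (K i) /\ subsetP' (K i) N,
       K k = N & forall i, (i < k)%N -> ssubset (K i) (K i.+1)].
  by case/main=> K [K1 _ K2]; apply: hb K1 K2.
elim: k N hN {hb} => [|k IH] N hN.
  by move=> JN; exists (fun _ => N); split=> // i _; do 2! [split=> //].
move=> cN; have JN := chain_sub cN; case: cN => M [hM /(IH M hM)[K [K1 K2 K3]] MN].
exists (fun i => if (i <= k)%N then K i else N); split.
- move=> i _; case: ifP => [/K1[? [? KM]]|_] //; split=> //; split=> // x /KM.
  by case: MN => + _; apply.
- by rewrite /= ltnn.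
- move=> i ltik; have /orP[/eqP->|lti] : (i == k) || (i < k)%N; last first.
  - by rewrite /= (ltnW lti) lti; apply: K3.
  - by rewrite /= leqnn ltnn K2.
  - by rewrite -leq_eqVlt -ltnS.
Qed.

Definition length_leq J N b := forall k, idl_chain J N k -> (k <= b)%N.

Lemma length_leq_trans J N P (a b : nat) : is_ideal J -> is_ideal N -> is_ideal P ->
  subsetP' J N -> subsetP' N P ->
  length_leq J N a -> length_leq N P b -> length_leq J P (a + b).
Proof.
move=> hJ hN hP JN NP ha hb k /(chain_split (V := R^o) hJ hN hP JN NP).
by case=> k1 [k2 [-> /ha h1 /hb h2]]; apply: leq_add.
Qed.

Lemma length_leqS J J' N N' b : subsetP' J J' -> subsetP' N' N ->
  length_leq J N b -> length_leq J' N' b.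
Proof. by move=> JJ' NN' h k c; apply: h; apply: chain_le c. Qed.

Lemma length_leq0 J N : subsetP' N J -> length_leq J N 0.
Proof. by move=> NJ [|k] // [K [_ /chain_sub JK [_ [x [/NJ/JK]]]]]. Qed.

(** The map r -> r g presents (J + (g))/J as a quotient of R/a. *)
Lemma length_leq_adj J a g L : is_ideal J -> (forall r, a r -> J (r * g)) ->
  length_leq a (fun _ => True) L -> length_leq J (idl_adj J g) L.
Proof.
move=> hJ hag hL k.
have hlin : linear (fun r : R^o => r * g : R^o).
  by move=> b u v; rewrite mulrDl scalerAl.
pose h : {linear R^o -> R^o} := HB.pack (fun r : R^o => r * g : R^o)
  (GRing.isLinear.Build R R^o R^o *:%R _ hlin).
move=> /(chain_preim (h := h) (idl_adj_ideal g hJ)) c; apply: hL.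
apply: chain_le (c _) => //= y [u [v [Ju [w _ ->] ->]]].
by exists w; rewrite [w * g]mulrC addrK.
Qed.

Lemma length_leq_gen J a s L : is_ideal J -> (forall g r, g \in s -> a r -> J (r * g)) ->
  length_leq a (fun _ => True) L -> length_leq J (idl_gen J s) (L * size s).
Proof.
move=> hJ + hL; elim: s => [|g s IH] hs; first by rewrite muln0; apply: length_leq0.
have hJs := idl_gen_ideal s hJ.
rewrite /= mulnS addnC; apply: (@length_leq_trans _ (idl_gen J s)) => //.
- exact: idl_adj_ideal.
- exact: idl_gen_base.
- exact: idl_adjl.
- by apply: IH => h r hr; apply: hs; rewrite inE hr orbT.
- apply: length_leq_adj hL => // r ar; apply: idl_gen_base; apply: hs => //.
  by rewrite inE eqxx.
Qed.

(** Each layer (J, x^i)/(J, x^(i+1)) is cyclic, generated by x^i and killed by (J, x), so it has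
    length at most [L]. *)
Lemma length_leq_adjX J x L (N : nat) : is_ideal J ->
  length_leq (idl_adj J x) (fun _ => True) L ->
  length_leq (idl_adj J (x ^+ N)) (fun _ => True) (L * N).
Proof.
move=> hJ hL; elim: N => [|N IH].
  rewrite muln0; apply: length_leq0 => y _; apply: idl_addr => //.
  by exists y; rewrite ?mul1r.
have hN := idl_adj_ideal (x ^+ N) hJ; have hN1 := idl_adj_ideal (x ^+ N.+1) hJ.
have sN : subsetP' (idl_adj J (x ^+ N.+1)) (idl_adj J (x ^+ N)).
  apply: idl_adj_sub => //; first exact: idl_adjl.
  by rewrite exprS; apply: idlM => //; apply: idl_adjr.
rewrite mulnS; apply: (@length_leq_trans _ (idl_adj J (x ^+ N))) => //.
have := @length_leq_adj (idl_adj J (x ^+ N.+1)) (idl_adj J x) (x ^+ N) L hN1.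
move=> H; apply: length_leqS (H _ hL) => //.
  apply: idl_adj_sub; [exact: idl_adj_ideal | | exact: idl_adjr].
  by move=> y Jy; do 2! apply: idl_adjl.
move=> _ [u [_ [Ju [v _ ->] ->]]]; rewrite mulrDl; apply: idlD => //.
  by apply: idl_adjl; apply: idlMr.
by apply: idl_addr => //; exists v; rewrite // mulrAC -exprS.
Qed.

(** The generators are raised to the power [N] one at a time, each at the price of a factor [N];
    [idl_gen_adj] moves the current generator into the base ideal while the induction treats the
    others. *)
Lemma length_leq_genX J s L (N : nat) : is_ideal J ->
  length_leq (idl_gen J s) (fun _ => True) L ->
  length_leq (idl_gen J [seq x ^+ N | x <- s]) (fun _ => True) (L * N ^ size s).
Proof.
elim: s J L => [|x s IH] J L hJ hL; first by rewrite muln1.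
rewrite /= expnSr mulnA; apply: length_leq_adjX; first exact: idl_gen_ideal.
rewrite -idl_gen_adj //; apply: IH; first exact: idl_adj_ideal.
by rewrite idl_gen_adj.
Qed.

Lemma length_leq_local m : is_local m -> length_leq m (fun _ => True) 1.
Proof.
case=> _ hm [|[|k]] // [K [hK [K' [hK' /chain_sub mK' [K'K [x [Kx nK'x]]]]]]].
case=> _ [y [_ nKy]]; case: nK'x; apply: mK'; apply: (hm K) => // K1.
by apply: nKy; rewrite -[y]mulr1; apply: (@idlM R K).
Qed.

Lemma length_leq_local_pow m k : noetherian R -> is_local m ->
  exists L, length_leq (idl_pow m k) (fun _ => True) L.
Proof.
move=> hn hloc; have hm : is_ideal m by case: hloc => -[].
elim: k => [|k [L hL]]; first by exists 0%N; apply: length_leq0.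
have hk := idl_pow_ideal k hm; have hk1 := idl_pow_ideal k.+1 hm.
have [s defs] := noetherian_fg hn hk.
exists (1 * size s + L)%N; apply: length_leq_trans hL => //.
  exact: idl_pow_dec.
apply: length_leqS (length_leq_gen (J := idl_pow m k.+1) hk1 _ (length_leq_local hloc)) => //.
  rewrite {1}defs; apply: idl_gen_sub; first exact: idl_gen_ideal.
    by move=> x ->; apply: idl0; apply: idl_gen_ideal.
  by move=> x; apply: idl_gen_mem.
move=> g r gs mr.
have kg : idl_pow m k g by rewrite defs; apply: idl_gen_mem => //; apply: idl_zero_ideal.
by rewrite mulrC; apply: idl_mulI.
Qed.

End Length.

(** * Systems of parameters *)

Section SystemOfParameters.
Variable R : comRingType.
Implicit Types (J K P Q : R -> Prop) (ps : list (R -> Prop)).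

Definition idl_prodl ps : R -> Prop := foldr (@idl_mul R) (fun _ => True) ps.

Lemma idl_prodl_ideal ps : is_ideal (idl_prodl ps).
Proof. by elim: ps => [|P ps IH] //=; apply: idl_mul_ideal. Qed.

Lemma idl_prodl_cat ps qs :
  idl_prodl (ps ++ qs) = idl_mul (idl_prodl ps) (idl_prodl qs).
Proof.
elim: ps => [|P ps IH] /=; last by rewrite IH idl_mulA.
by rewrite idl_mul1l //; apply: idl_prodl_ideal.
Qed.

Lemma prime_sub_prodl P ps : is_prime P -> subsetP' (idl_prodl ps) P ->
  exists2 Q, List.In Q ps & subsetP' Q P.
Proof.
move=> [hP [P1 Pprime]]; elim: ps => [|Q ps IH] /=; first by move/(_ 1 I).
move=> QP; have [|/not_subset[x Qx nPx]] := classic (subsetP' Q P); first by exists Q; auto.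
case: IH => [y psy|Q' ps' Q'P]; last by exists Q'; auto.
by case: (Pprime x y) => //; apply: QP; apply: idl_mulI.
Qed.

(** Noetherian induction: a maximal counterexample K is not prime, and if x y lies in K the lists
    for K + (x) and K + (y) combine. Every prime over J contains a member of [ps], so all minimal
    primes over J occur in it. *)
Lemma ideal_prime_product J : noetherian R -> is_ideal J -> exists ps,
  (forall P, List.In P ps -> is_prime P /\ subsetP' J P) /\ subsetP' (idl_prodl ps) J.
Proof.
move=> hn hJ; apply: NNPP => nJ.
pose good J := exists ps,
  (forall P, List.In P ps -> is_prime P /\ subsetP' J P) /\ subsetP' (idl_prodl ps) J.
have [||K [[hK nK] Kmax]] := @noetherian_max _ hn (fun K => is_ideal K /\ ~ good K) J.
- by split.
- by move=> K [].
have K1 : ~ K 1.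
  by move=> K1; apply: nK; exists [::]; split=> // x _; rewrite (idl_eqT hK K1).
have [Kp|nKp] := classic (is_prime K).
  apply: nK; exists [:: K]; split=> [P [<-|[]]|]; first by split.
  exact: idl_mul_subl hK.
have [x [y [Kxy nKx nKy]]] : exists x y, [/\ K (x * y), ~ K x & ~ K y].
  apply: NNPP => nxy; apply: nKp; split=> //; split=> // x y Kxy.
  apply: NNPP => /not_or_and[nKx nKy]; apply: nxy; by exists x, y.
have goodadj z : ~ K z -> good (idl_adj K z).
  move=> nKz; apply: NNPP => nz; apply: nKz; apply: (Kmax (idl_adj K z)).
  - by split=> //; apply: idl_adj_ideal.
  - exact: idl_adjl.
  - exact: idl_adjr.
have [ps [ps1 ps2]] := goodadj x nKx; have [qs [qs1 qs2]] := goodadj y nKy.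
apply: nK; exists (ps ++ qs); split=> [P /List.in_app_iff[/ps1|/qs1] [Pp KP]|].
- by split=> // z Kz; apply/KP/idl_adjl.
- by split=> // z Kz; apply/KP/idl_adjl.
rewrite idl_prodl_cat; apply: idl_mul_sub => // u v.
move=> /ps2[a [_ [Ka [b _ ->] ->]]] /qs2[c [_ [Kc [e _ ->] ->]]].
rewrite mulrDl; apply: idlD => //; first exact: idlMr.
rewrite mulrDr; apply: idlD => //; first exact: idlM.
by rewrite mulrACA; apply: idlMr.
Qed.

(** The predicate [C] selects the primes to be avoided in place of filtering the list. Two selected
    primes may coincide but not be strictly nested, which makes the correction term in the induction
    possible. *)
Lemma prime_avoidance (C : (R -> Prop) -> Prop) J ps : is_ideal J ->
  (forall P, List.In P ps -> is_prime P) ->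
  (forall P, List.In P ps -> C P -> ~ subsetP' J P) ->
  (forall P Q, List.In P ps -> List.In Q ps -> C P -> C Q ->
     subsetP' P Q -> subsetP' Q P) ->
  exists2 x, J x & forall P, List.In P ps -> C P -> ~ P x.
Proof.
move=> hJ; elim: ps => [|P ps IH] pr CJ inc; first by exists 0; [apply: idl0|].
have [Q Qps|Q Qps|P' Q P'ps Qps|x Jx xps] := IH; first by apply: pr; right.
- by apply: CJ; right.
- by apply: inc; right.
have [[CP Px]|nPx] := classic (C P /\ P x); last first.
  by exists x => // Q [<-|/xps]; auto => CP Px; apply: nPx.
(* Correction term: adding y moves x out of P and does not change it modulo the other selected
   primes. *)
have [y [Jy nPy yps]] : exists y, [/\ J y, ~ P y &
    forall Q, List.In Q ps -> C Q -> Q y].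
  have [hP [P1 Pprime]] := pr P (or_introl erefl).
  have : forall Q, List.In Q ps -> C Q -> is_ideal Q /\ ~ subsetP' Q P.
    move=> Q Qps CQ; split; first by case: (pr Q (or_intror Qps)).
    by move=> /(inc _ _ (or_intror Qps) (or_introl erefl) CQ CP)/(_ _ Px); apply: xps.
  elim: {IH pr inc xps} ps CJ => [|Q ps IH] CJ psP.
    by have /not_subset[y Jy nPy] := CJ P (or_introl erefl) CP; exists y.
  case: IH => [P' [<-|P'ps]|Q' Q'ps|y [Jy nPy yps]].
  - by apply: CJ; left.
  - by apply: CJ; do 2! right.
  - by apply: psP; right.
  have [CQ|nCQ] := classic (C Q); last by exists y; split=> // Q' [<-|/yps].
  have [hQ /not_subset[z Qz nPz]] := psP Q (or_introl erefl) CQ.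
  exists (z * y); split; [exact: idlM | by case/Pprime | move=> Q' [<- _|Q'ps CQ']].
    exact: idlMr.
  by have [hQ' _] := psP Q' (or_intror Q'ps) CQ'; apply: idlM => //; apply: yps.
exists (x + y); first exact: idlD.
move=> Q [<- _|Qps CQ].
  have [hP _] := pr P (or_introl erefl).
  by move=> Pxy; apply: nPy; rewrite -[y](addKr x) addrC; apply: idlB.
have [hQ _] := pr Q (or_intror Qps).
move=> Qxy; apply: (xps Q) => //; rewrite -[x](addrK y); apply: idlB => //; exact: yps.
Qed.

Lemma prime_chain_cons P k c : is_prime P -> ssubset P (c 0%N) ->
  prime_chain (@is_prime R) k c ->
  prime_chain (@is_prime R) k.+1 (fun i => if i is i'.+1 then c i' else P).
Proof. by move=> hP Pc [c1 c2]; split=> [[|i]|[|i]] //; [apply: c1 | apply: c2]. Qed.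

(** Working relative to J, with the dimension of R/J measured by chains of primes above J, lets the
    induction add one parameter to J at a time. When [d] is 0, every prime over J is m, and a
    product of such primes lies in J. *)
Lemma system_of_parameters m d J : noetherian R -> is_local m -> is_ideal J ->
  (forall k c, prime_chain (@is_prime R) k c -> subsetP' J (c 0%N) -> (k <= d)%N) ->
  exists s k, [/\ size s = d, forall x, x \in s -> m x &
    subsetP' (idl_pow m k) (idl_gen J s)].
Proof.
move=> hn hloc; have [[hm [m1 _]] mmax] := hloc.
have mprime : is_prime m.
  split=> //; split=> // x y mxy; apply: NNPP => /not_or_and[nx ny].
  have adj1 z : ~ m z -> idl_adj m z 1.
    move=> nz; apply: NNPP => n1; apply: nz.
    by apply: (mmax _ _ n1); [apply: idl_adj_ideal | apply: idl_adjr].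
  have [a [_ [ma [b _ ->] e1]]] := adj1 x nx; have [c [_ [mc [e _ ->] e2]]] := adj1 y ny.
  apply: m1; rewrite -[1]mulr1 {1}e1 e2.
  have -> : (a + x * b) * (c + y * e) = a * (c + y * e) + (x * b * c + x * y * (b * e)) by ring.
  apply: idlD => //; first exact: idlMr.
  by apply: idlD => //; [apply: idlM | apply: idlMr].
have sub_m P : is_prime P -> subsetP' P m by case=> hP [P1 _]; apply: mmax.
elim: d J => [|d IH] J hJ hd.
all: have [ps [ps1 ps2]] := ideal_prime_product hn hJ.
  exists [::], (size ps); split=> // x /= mx; apply: ps2.
  have {}ps1 P : List.In P ps -> subsetP' m P.
    move=> /ps1[Pp JP]; apply: NNPP => /not_subset[y my nPy].
    suff : prime_chain (@is_prime R) 1 (fun i => if i is 0%N then P else m).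
      by move=> /hd/(_ JP).
    split=> [[|[|i]]|[|i]] // _; split; first exact: sub_m.
    by exists y.
  elim: ps ps1 x mx => [|P ps IHp] ps1 //= x.
  rewrite idl_mulC; apply: idl_mulS; first by apply: ps1; left.
  by apply: IHp => Q Qps; apply: ps1; right.
(* Only the members of [ps] that start a chain of the maximal length d + 1 have to be avoided. They
   are not strictly nested, as otherwise a longer chain would exist. *)
pose C P := exists2 c, prime_chain (@is_prime R) d.+1 c & c 0%N = P.
have [P /ps1[]|P _ [c [c1 c2] <-] mc|P Q Pps Qps [c hc eP] [c' hc' eQ] cc'|x mx xps] :=
  @prime_avoidance C m ps hm => //.
- have [_ [y [c1y nc0y]]] := c2 0%N isT.
  by apply/nc0y/mc/(sub_m (c 1%N)) => //; apply: c1.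
- subst P Q; apply: NNPP => /not_subset[y c'y ncy].
  have hc0 : is_prime (c 0%N) by case: hc => + _; apply.
  have cc0 : ssubset (c 0%N) (c' 0%N) by split=> //; exists y.
  have := hd _ _ (prime_chain_cons hc0 cc0 hc').
  by rewrite ltnn => /(_ (proj2 (ps1 _ Pps))).
have [||s [k [ss ms mk]]] := IH (idl_adj J x).
- exact: idl_adj_ideal.
- move=> k c hc Jc; have Jc0 : subsetP' J (c 0%N) by move=> y Jy; apply/Jc/idl_adjl.
  have := hd _ _ hc Jc0; rewrite leq_eqVlt => /orP[/eqP ek|//]; subst k.
  have c0p : is_prime (c 0%N) by case: hc => + _; apply.
  (* A chain of length d + 1 above J + (x) starts over some P in [ps]. Either it starts at P, which
     x was chosen to avoid, or P prolongs it below. *)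
  have [|P Pps Pc] := prime_sub_prodl (ps := ps) c0p; first by move=> y /ps2/Jc0.
  have [Pp JP] := ps1 P Pps.
  have [cP|/not_subset[y c0y nPy]] := classic (subsetP' (c 0%N) P).
    case: (xps P Pps); first by exists c => //; apply: pred_ext.
    by apply/cP/Jc/idl_adjr.
  have Pc0 : ssubset P (c 0%N) by split=> //; exists y.
  by have := hd _ _ (prime_chain_cons Pp Pc0 hc) JP; rewrite ltnn.
exists (x :: s), k; split; first by rewrite /= ss.
  by move=> y; rewrite inE => /orP[/eqP->|/ms].
by rewrite /= -idl_gen_adj.
Qed.

(** The N-th powers of a system of parameters generate an ideal inside m^N whose colength is at most
    a constant times N^d. *)
Lemma length_leq_dim (m : R -> Prop) d : noetherian R -> is_local m -> dim_eq R d ->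
  exists C, forall N, length_leq (idl_pow m N) (fun _ => True) (C * N ^ d)%N.
Proof.
move=> hn hloc [_ hd]; have zid := idl_zero_ideal R.
have hm : is_ideal m by case: hloc => -[].
have [|s [k [ss ms mk]]] := @system_of_parameters m d _ hn hloc zid.
  by move=> k c /hd.
have [L hL] := length_leq_local_pow k hn hloc; exists L => N; rewrite -ss.
have hTT : subsetP' (fun _ : R => True) (fun _ => True) by [].
have hs := length_leq_genX (N := N) zid (length_leqS mk hTT hL).
apply: (length_leqS _ hTT hs).
apply: idl_gen_sub; first exact: idl_pow_ideal.
  by move=> x ->; apply: idl0; apply: idl_pow_ideal.
by move=> _ /mapP[x /ms mx ->]; apply: idl_powX1.
Qed.

End SystemOfParameters.

(** * The Artin-Rees lemma for the bigraded Rees algebra *)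

Section NoetherianSubring.
Variable T : comRingType.
Implicit Types A J : T -> Prop.

(** Subrings are predicates on one ambient ring, so that the Rees algebra can be treated inside
    [{poly {poly R}}]. *)
Definition subring A :=
  [/\ A 1, forall x y, A x -> A y -> A (x - y) & forall x y, A x -> A y -> A (x * y)].

Definition subring_ideal A J := [/\ subsetP' J A, J 0,
  forall x y, J x -> J y -> J (x + y) & forall a x, A a -> J x -> J (a * x)].

Definition noetherian_subring A := forall f : nat -> T -> Prop,
  (forall n, subring_ideal A (f n)) -> (forall n, subsetP' (f n) (f n.+1)) ->
  exists N, forall n, (N <= n)%N -> subsetP' (f n) (f N).

Definition adjoin A x : T -> Prop := fun y =>
  exists n (c : nat -> T), (forall i, A (c i)) /\ y = \sum_(i < n) c i * x ^+ i.

Lemma subring0 A : subring A -> A 0.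
Proof. by case=> A1 AB _; rewrite -(subrr 1); apply: AB. Qed.
Lemma subringN A x : subring A -> A x -> A (- x).
Proof. by move=> hA Ax; rewrite -sub0r; case: (hA) => _ + _; apply; first exact: subring0. Qed.
Lemma subringD A x y : subring A -> A x -> A y -> A (x + y).
Proof. by move=> hA Ax Ay; rewrite -[y]opprK; case: (hA) => _ + _; apply=> //; apply: subringN. Qed.

Lemma subring_ideal_sub A J x y : subring A -> subring_ideal A J -> J x -> J y -> J (x - y).
Proof.
move=> hA [_ _ JD JM] Jx Jy; apply: JD => //; rewrite -mulN1r; apply: JM => //.
by apply: subringN => //; case: hA.
Qed.

Lemma chain_mono (f : nat -> T -> Prop) : (forall n, subsetP' (f n) (f n.+1)) ->
  forall i j, (i <= j)%N -> subsetP' (f i) (f j).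
Proof.
move=> fS i j /subnKC<-; elim: (j - i)%N => [|n IH]; first by rewrite addn0.
by rewrite addnS => x /IH/fS.
Qed.

Section Adjoin.
Variables (A : T -> Prop) (x : T).
Hypothesis hA : subring A.

Lemma adjoin_sub : subsetP' A (adjoin A x).
Proof.
move=> a Aa; exists 1%N, (fun _ => a); split=> //.
by rewrite big_ord1 expr0 mulr1.
Qed.

Lemma adjoinD y z : adjoin A x y -> adjoin A x z -> adjoin A x (y + z).
Proof.
move=> [n [c [Ac ->]]] [p [e [Ae ->]]].
pose tr q (g : nat -> T) i := if (i < q)%N then g i else 0.
have trA q g : (forall i, A (g i)) -> forall i, A (tr q g i).
  by move=> Ag i; rewrite /tr; case: ifP => // _; apply: subring0.
have trE q (g : nat -> T) r : (q <= r)%N ->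
      \sum_(i < q) g i * x ^+ i = \sum_(i < r) tr q g i * x ^+ i.
  move=> qr; rewrite (big_ord_widen r (fun i => g i * x ^+ i)) // big_mkcond /=.
  by apply: eq_bigr => i _; rewrite /tr; case: ifP; rewrite ?mul0r.
exists (n + p)%N, (fun i => tr n c i + tr p e i); split.
  by move=> i; apply: subringD => //; apply: trA.
rewrite (trE n c _ (leq_addr p n)) (trE p e _ (leq_addl n p)) -big_split.
by apply: eq_bigr => i _; rewrite mulrDl.
Qed.

Lemma adjoinZ a y : A a -> adjoin A x y -> adjoin A x (a * y).
Proof.
move=> Aa [n [c [Ac ->]]]; exists n, (fun i => a * c i); split.
  by move=> i; case: hA => _ _; apply.
by rewrite mulr_sumr; apply: eq_bigr => i _; rewrite mulrA.
Qed.

Definition shift_coef (c : nat -> T) i := if i is i'.+1 then c i' else 0.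

Lemma shift_coef_in c : (forall i, A (c i)) -> forall i, A (shift_coef c i).
Proof. by move=> Ac [|i] //=; apply: subring0. Qed.

Lemma adjoin_shift n (c : nat -> T) :
  x * (\sum_(i < n) c i * x ^+ i) = \sum_(i < n.+1) shift_coef c i * x ^+ i.
Proof.
rewrite big_ord_recl mul0r add0r mulr_sumr; apply: eq_bigr => i _ /=.
by rewrite exprS mulrCA.
Qed.

Lemma adjoinX y : adjoin A x y -> adjoin A x (x * y).
Proof.
move=> [n [c [Ac ->]]]; rewrite adjoin_shift; exists n.+1, (shift_coef c); split=> //.
exact: shift_coef_in.
Qed.

Lemma adjoin_subring : subring (adjoin A x).
Proof.
have A1 : A 1 by case: hA.
split; first exact: adjoin_sub.
  move=> y z Ay Az; apply: adjoinD => //; rewrite -mulN1r; apply: adjoinZ => //.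
  exact: subringN.
move=> _ z [n [c [Ac ->]]] Az; rewrite mulr_suml.
apply: (big_ind (adjoin A x)); [by apply: adjoin_sub; apply: subring0 | exact: adjoinD |].
move=> i _; rewrite -mulrA; apply: adjoinZ => //.
by elim: (val i) => [|j IH]; rewrite ?mul1r // exprS -mulrA; apply: adjoinX.
Qed.

Lemma adjoin_gen : adjoin A x x.
Proof. by have [A1 _ _] := hA; have := adjoinX (adjoin_sub A1); rewrite mulr1. Qed.

Lemma adjoin_min B : subring B -> subsetP' A B -> B x -> subsetP' (adjoin A x) B.
Proof.
move=> hB AB Bx _ [n [c [Ac ->]]]; have [B1 _ BM] := hB.
apply: (big_ind B); [exact: subring0 | by move=> u v; apply: subringD |].
move=> i _; apply: (BM); first exact: AB.
by elim: (val i) => [|j IH] //; rewrite exprS; apply: BM.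
Qed.

(** Hilbert's basis theorem. As x may be algebraic over A, leading coefficients refer to expressions
    in x and not to elements. *)
Lemma adjoin_noetherian : noetherian_subring A -> noetherian_subring (adjoin A x).
Proof.
move=> noeA J hJ JS; have [A1 AB AM] := hA.
pose L n k a := A a /\ exists c : nat -> T, (forall i, A (c i)) /\
  J n (\sum_(i < k) c i * x ^+ i + a * x ^+ k).
have hL n k : subring_ideal A (L n k).
  have [_ J0 JD JM] := hJ n; split=> [a []||a b|a b] //.
  - split; first exact: subring0.
    exists (fun _ => 0); split=> [i|]; first exact: subring0.
    by rewrite mul0r addr0 big1 // => i _; rewrite mul0r.
  - move=> [Aa [c [Ac Jc]]] [Ab [e [Ae Je]]]; split; first exact: subringD.
    exists (fun i => c i + e i); split=> [i|]; first exact: subringD.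
    under eq_bigr do rewrite mulrDl.
    by rewrite big_split mulrDl addrACA; apply: JD.
  - move=> Aa [Ab [e [Ae Je]]]; split; first exact: AM.
    exists (fun i => a * e i); split=> [i|]; first exact: AM.
    under eq_bigr do rewrite -mulrA.
    by rewrite -mulr_sumr -mulrA -mulrDr; apply: JM => //; apply: adjoin_sub.
have LS n k : subsetP' (L n k) (L n.+1 k).
  by move=> a [Aa [c [Ac Jc]]]; split=> //; exists c; split=> //; apply: JS.
have LSk n k : subsetP' (L n k) (L n k.+1).
  move=> a [Aa [c [Ac Jc]]]; split=> //.
  have [_ _ _ JM] := hJ n; have := JM _ _ adjoin_gen Jc.
  rewrite mulrDr adjoin_shift mulrCA -exprS => Jc'; exists (shift_coef c); split=> //.
  exact: shift_coef_in.
have Lm n n' k k' : (n <= n')%N -> (k <= k')%N -> subsetP' (L n k) (L n' k').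
  move=> nn' kk' a La; apply: (chain_mono (LSk n') kk').
  exact: (chain_mono (f := fun n => L n k) (LS^~ k) nn').
(* [L n k] grows in both indices. Stability of the diagonal settles all [k >= N0], and the finitely
   many smaller [k] are settled one by one. *)
have [N0 hN0] := noeA (fun n => L n n) (fun n => hL n n)
  (fun n => Lm _ _ _ _ (leqnSn n) (leqnSn n)).
have [N1 hN1] : exists N, forall k, (k < N0)%N -> forall n, (N <= n)%N ->
    subsetP' (L n k) (L N k).
  elim: (N0) => [|K [N hN]]; first by exists 0%N.
  have [M hM] := noeA (L^~ K) (hL^~ K) (LS^~ K).
  exists (maxn N M) => k kK n; rewrite geq_max => /andP[Nn Mn] a.
  move: kK; rewrite ltnS leq_eqVlt => /orP[/eqP->|kK].
    by move/(hM _ Mn); apply: Lm; rewrite ?leq_maxr.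
  by move/(hN _ kK _ Nn); apply: Lm; rewrite ?leq_maxl.
exists (maxn N0 N1) => n; rewrite geq_max => /andP[N0n N1n].
have JNn : subsetP' (J (maxn N0 N1)) (J n).
  by apply: chain_mono; rewrite // geq_max N0n.
have LN k : subsetP' (L n k) (L (maxn N0 N1) k).
  have [N0k|kN0] := leqP N0 k => a La.
    apply: (Lm N0 _ N0); rewrite ?leq_maxl //; apply: (hN0 (maxn n k)).
      by rewrite leq_max N0n.
    by apply: Lm La; rewrite ?leq_maxl ?leq_maxr.
  by apply: (Lm N1 _ k); rewrite ?leq_maxr //; apply: hN1 La.
(* Induction on the length of an expression for y: an element of the stable ideal with the same
   leading coefficient is subtracted. *)
move=> y Jy; have [JA _ _ _] := hJ n; have [k [c [Ac defy]]] := JA y Jy.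
move: defy Jy; elim: k y c Ac => [|k IH] y c Ac defy Jy.
  by rewrite defy big_ord0; case: (hJ (maxn N0 N1)).
have [|_ [e [Ae Je]]] := LN k (c k).
  by split=> //; exists c; split=> //; move: Jy; rewrite defy big_ord_recr.
rewrite -[y](subrK (\sum_(i < k) e i * x ^+ i + c k * x ^+ k)).
have [_ _ JD _] := hJ (maxn N0 N1); apply: JD => //.
apply: (IH _ (fun i => c i - e i)); first by move=> i; apply: AB.
  rewrite defy big_ord_recr /= opprD addrACA subrr addr0 -sumrB.
  by apply: eq_bigr => i _; rewrite mulrBl.
by apply: (subring_ideal_sub adjoin_subring (hJ n)) => //; apply: JNn.
Qed.

End Adjoin.

Definition adjoin_seq A (s : seq T) : T -> Prop := foldr (fun x B => adjoin B x) A s.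

Lemma adjoin_seq_subring A s : subring A -> subring (adjoin_seq A s).
Proof. by move=> hA; elim: s => [|x s IH] //=; apply: adjoin_subring. Qed.

Lemma adjoin_seq_noetherian A s :
  subring A -> noetherian_subring A -> noetherian_subring (adjoin_seq A s).
Proof.
move=> hA noeA; elim: s => [|x s IH] //=; apply: adjoin_noetherian => //.
exact: adjoin_seq_subring.
Qed.

Lemma adjoin_seq_min A s B : subring B -> subsetP' A B -> (forall x, x \in s -> B x) ->
  subsetP' (adjoin_seq A s) B.
Proof.
move=> hB AB; elim: s => [|x s IH] //= sB; apply: adjoin_min => //.
  by apply: IH => y ys; apply: sB; rewrite inE ys orbT.
by apply: sB; rewrite inE eqxx.
Qed.

Lemma adjoin_seq_sub A s : subsetP' A (adjoin_seq A s).
Proof. by elim: s => [|x s IH] //= a /IH; apply: adjoin_sub. Qed.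

Lemma adjoin_seq_mem A s x : subring A -> x \in s -> adjoin_seq A s x.
Proof.
move=> hA; elim: s => [|y s IH] //=; rewrite inE => /orP[/eqP->|/IH].
  by apply: adjoin_gen; apply: adjoin_seq_subring.
exact: adjoin_sub.
Qed.

End NoetherianSubring.

(** * The Rees algebra R[m v, I t] and Artin-Rees bounds uniform in the power of I *)

Section ArtinRees.
Variables (R : comRingType) (m I : R -> Prop).
Hypotheses (hnoeth : noetherian R) (hm : is_ideal m) (hI : is_ideal I).

Notation mI b s := (idl_mul (idl_pow m b) (idl_pow I s)).

Lemma mI_ideal b s : is_ideal (mI b s).
Proof. by apply: idl_mul_ideal; apply: idl_pow_ideal. Qed.

Lemma mI_mul b s b' s' x y : mI b s x -> mI b' s' y -> mI (b + b') (s + s') (x * y).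
Proof. by move=> hx hy; rewrite !idl_powD // idl_mulACA; apply: idl_mulI. Qed.

(* [bimon b s x] is [x v^b t^s], with [v] the inner and [t] the outer variable. *)
Definition bimon b s (x : R) : {poly {poly R}} := (x *: 'X^b) *: 'X^s.

Lemma bimon_coef b s x b' s' :
  (bimon b s x)`_s'`_b' = if (b' == b) && (s' == s) then x else 0.
Proof.
rewrite /bimon coefZ coefXn; case: (s' == s); rewrite ?andbT ?andbF ?mulr1 ?mulr0 ?coef0 //.
by rewrite coefZ coefXn; case: (b' == b); rewrite ?mulr1 ?mulr0.
Qed.

Lemma bimonM b s x b' s' x' :
  bimon b s x * bimon b' s' x' = bimon (b + b') (s + s') (x * x').
Proof.
rewrite /bimon -scalerAl -scalerAr -exprD scalerA.
by rewrite -scalerAl -scalerAr -exprD scalerA.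
Qed.

Lemma bimonD b s x y : bimon b s (x + y) = bimon b s x + bimon b s y.
Proof. by rewrite /bimon !scalerDl. Qed.

Lemma bimon0 b s : bimon b s 0 = 0.
Proof. by rewrite /bimon !scale0r. Qed.

Lemma coefM2 (p q : {poly {poly R}}) b s :
  (p * q)`_s`_b = \sum_(i < s.+1) \sum_(j < b.+1) p`_i`_j * q`_(s - i)`_(b - j).
Proof. by rewrite coefM coef_sum; apply: eq_bigr => i _; rewrite coefM. Qed.

Definition bi_const (p : {poly {poly R}}) := exists x, p = bimon 0 0 x.

Lemma bi_const_subring : subring bi_const.
Proof.
split; first by exists 1; rewrite /bimon !expr0 !scale1r.
  move=> _ _ [x ->] [y ->]; exists (x - y).
  by rewrite bimonD; congr (_ + _); rewrite /bimon !scaleNr.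
by move=> _ _ [x ->] [y ->]; exists (x * y); rewrite bimonM.
Qed.

Lemma bi_const_noetherian : noetherian_subring bi_const.
Proof.
move=> f hf fS; have [||N hN] := @hnoeth (fun n x => f n (bimon 0 0 x)).
- move=> n; have [_ f0 fD fM] := hf n; split; first by rewrite bimon0.
  split=> [x y fx fy|a x fx]; first by rewrite bimonD; apply: fD.
  by rewrite -[a * x]/(a * x) -[bimon 0 0 _](bimonM 0 0 a 0 0 x); apply: fM => //; exists a.
- by move=> n x; apply: fS.
exists N => n Nn p fp; have [fc _ _ _] := hf n.
by have [x defp] := fc p fp; move: fp; rewrite defp; apply: hN.
Qed.

Definition bi_rees (p : {poly {poly R}}) := forall b s, mI b s p`_s`_b.

Lemma bi_rees_bimon b s x : mI b s x -> bi_rees (bimon b s x).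
Proof.
move=> hx b' s'; rewrite bimon_coef; case: ifP => [/andP[/eqP-> /eqP->]|_] //.
by apply: idl0; apply: mI_ideal.
Qed.

Lemma bi_rees_subring : subring bi_rees.
Proof.
split.
- have -> : 1 = bimon 0 0 1 by rewrite /bimon !expr0 !scale1r.
  by apply: bi_rees_bimon; rewrite /= idl_mul1l.
- by move=> p q hp hq b s; rewrite !coefB; apply: idlB => //; apply: mI_ideal.
- move=> p q hp hq b s; rewrite coefM2.
  apply: idl_sum => [|i _]; first exact: mI_ideal.
  apply: idl_sum => [|j _]; first exact: mI_ideal.
  have ib : (j <= b)%N by rewrite -ltnS.
  have is' : (i <= s)%N by rewrite -ltnS.
  by have := mI_mul (hp j i) (hq (b - j)%N (s - i)%N); rewrite !subnKC.
Qed.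

(** A is generated over R by the f v and g t, for f and g in finite generating sets of m and I. The
    last two clauses place it between the homogeneous elements and the whole Rees algebra. *)
Lemma rees_generated : exists A : {poly {poly R}} -> Prop,
  [/\ subring A, noetherian_subring A, subsetP' A bi_rees &
      forall b s x, mI b s x -> A (bimon b s x)].
Proof.
have [fs defm] := noetherian_fg hnoeth hm; have [gs defI] := noetherian_fg hnoeth hI.
have zid := idl_zero_ideal R.
pose s := [seq bimon 1 0 f | f <- fs] ++ [seq bimon 0 1 g | g <- gs].
pose A := adjoin_seq bi_const s.
have hA : subring A by apply: adjoin_seq_subring; apply: bi_const_subring.
have Aid b s' : is_ideal (fun x => A (bimon b s' x)).
  split; first by rewrite bimon0; apply: subring0.
  split=> [x y Ax Ay|a x Ax]; first by rewrite bimonD; apply: subringD.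
  rewrite -[b]add0n -[s']add0n -bimonM; case: (hA) => _ _; apply=> //.
  by apply: adjoin_seq_sub; exists a.
have Am x : m x -> A (bimon 1 0 x).
  rewrite defm; apply: (idl_gen_sub (K := fun x => A (bimon 1 0 x))); first exact: Aid.
    by move=> _ ->; exact: idl0 (Aid _ _).
  move=> f ffs; apply: adjoin_seq_mem; first exact: bi_const_subring.
  by rewrite mem_cat map_f.
have AI x : I x -> A (bimon 0 1 x).
  rewrite defI; apply: (idl_gen_sub (K := fun x => A (bimon 0 1 x))); first exact: Aid.
    by move=> _ ->; exact: idl0 (Aid _ _).
  move=> f ffs; apply: adjoin_seq_mem; first exact: bi_const_subring.
  by rewrite mem_cat (map_f (bimon 0 1)) ?orbT.
have Amb b x : idl_pow m b x -> A (bimon b 0 x).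
  elim: b x => [|b IH] x; first by move=> _; apply: adjoin_seq_sub; exists x.
  apply: (idl_mul_sub (L := fun x => A (bimon b.+1 0 x))) x; first exact: Aid.
  move=> x y /IH Ax /Am Ay; rewrite -addn1 -[0%N]addn0 -bimonM.
  by case: hA => _ _; apply.
have AIb b x : idl_pow I b x -> A (bimon 0 b x).
  elim: b x => [|b IH] x; first by move=> _; apply: adjoin_seq_sub; exists x.
  apply: (idl_mul_sub (L := fun x => A (bimon 0 b.+1 x))) x; first exact: Aid.
  move=> x y /IH Ax /AI Ay; rewrite -addn1 -[0%N]addn0 -bimonM.
  by case: hA => _ _; apply.
exists A; split=> //.
- by apply: adjoin_seq_noetherian; [apply: bi_const_subring | apply: bi_const_noetherian].
- apply: adjoin_seq_min; first exact: bi_rees_subring.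
    by move=> _ [x ->]; apply: bi_rees_bimon; rewrite /= idl_mul1l.
  move=> p; rewrite mem_cat => /orP[] /mapP[x xs ->]; apply: bi_rees_bimon.
    rewrite idl_mulC idl_mul1l; last exact: idl_pow_ideal.
    by rewrite idl_pow1 // defm; apply: idl_gen_mem.
  rewrite idl_mul1l; last exact: idl_pow_ideal.
  by rewrite idl_pow1 // defI; apply: idl_gen_mem.
- move=> b s'; apply: (idl_mul_sub (L := fun x => A (bimon b s' x))); first exact: Aid.
  move=> x y /Amb Ax /AIb Ay; rewrite -[b]addn0 -[s']add0n -bimonM.
  by case: hA => _ _; apply.
Qed.

(** The U b s are the components of a bigraded ideal of the Rees algebra, which is generated in
    v-degrees at most c for some c. The point is that this c serves all s. *)
Lemma artin_rees (U : nat -> nat -> R -> Prop) :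
  (forall b s, is_ideal (U b s)) -> (forall b s, subsetP' (U b s) (mI b s)) ->
  (forall b s x y, m x -> U b s y -> U b.+1 s (x * y)) ->
  (forall b s x y, I x -> U b s y -> U b s.+1 (x * y)) ->
  exists c, forall t s, subsetP' (U (c + t)%N s) (idl_mul (idl_pow m t) (U c s)).
Proof.
move=> hU Usub Um UI.
have Umj b s j : subsetP' (idl_mul (idl_pow m j) (U b s)) (U (b + j)%N s).
  apply: idl_mul_sub => // x y mx Uy; elim: j x mx => [|j IH] x.
    by move=> _; rewrite addn0; apply: idlM.
  move: x; rewrite addnS; apply: (idl_mul_min (L := fun x => U (b + j).+1 s (x * y))).
  - by rewrite mul0r; apply: idl0.
  - by move=> u v; rewrite mulrDl; apply: idlD.
  - by move=> u v /IH Uu mv; rewrite mulrAC mulrC; apply: Um.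
have UIi b s i : subsetP' (idl_mul (idl_pow I i) (U b s)) (U b (s + i)%N).
  apply: idl_mul_sub => // x y mx Uy; elim: i x mx => [|j IH] x.
    by move=> _; rewrite addn0; apply: idlM.
  move: x; rewrite addnS; apply: (idl_mul_min (L := fun x => U b (s + j).+1 (x * y))).
  - by rewrite mul0r; apply: idl0.
  - by move=> u v; rewrite mulrDl; apply: idlD.
  - by move=> u v /IH Uu mv; rewrite mulrAC mulrC; apply: UI.
(* The graded ideals [V c] generated by the components [U b s] with [b <= c] form
   an ascending chain. *)
pose V c b s := idl_mul (idl_pow m (b - c)) (U (minn b c) s).
have hV c b s : is_ideal (V c b s) by apply: idl_mul_ideal.
have VM c b s j i : subsetP' (idl_mul (mI j i) (V c b s)) (V c (b + j)%N (s + i)%N).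
  (* Of the j factors from m, j1 raise the first index of U up to its cap c; the other j2 remain as
     a power of m. *)
  have [j1 [j2 [-> e1 e2]]] : exists j1 j2, [/\ j = (j2 + j1)%N,
      minn (b + j) c = (minn b c + j1)%N & (b + j - c = j2 + (b - c))%N].
    exists (minn (b + j) c - minn b c)%N, (b + j - c - (b - c))%N.
    by split; lia.
  rewrite /V; have -> : minn (b + (j2 + j1)) c = (minn b c + j1)%N by lia.
  have -> : (b + (j2 + j1) - c = j2 + (b - c))%N by lia.
  rewrite !idl_powD // -[idl_mul (idl_mul _ (idl_pow m j1)) _]idl_mulA idl_mulACA.
  apply: idl_mulS => // x; rewrite -idl_mulA idl_mulCA => hx.
  by apply: UIi; apply: idl_mulS hx => //; apply: Umj.
have VS c b s : subsetP' (V c b s) (V c.+1 b s).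
  have [bc|cb] := leqP b c.
    rewrite /V (eqP bc) (minn_idPl bc) (minn_idPl (leqW bc)).
    by have -> : (b - c.+1 = 0)%N by lia.
  rewrite /V (minn_idPr (ltnW cb)) (minn_idPr cb).
  have -> : (b - c = (b - c.+1) + 1)%N by lia.
  rewrite idl_powD // -idl_mulA; apply: idl_mulS => // x /Umj.
  by rewrite addn1.
have [A [hA Anoeth ArB Amon]] := rees_generated.
have [||c hc] := Anoeth (fun c p => A p /\ forall b s, V c b s p`_s`_b).
- move=> c; split=> [p []||p q [Ap Vp] [Aq Vq]|p q Ap [Aq Vq]] //.
  + by split=> [|b s]; [apply: subring0 | rewrite !coef0; apply: idl0].
  + by split=> [|b s]; [apply: subringD | rewrite !coefD; apply: idlD].
  + split=> [|b s]; first by case: hA => _ _; apply.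
    rewrite coefM2; apply: idl_sum => // i _; apply: idl_sum => // j _.
    have ib : (j <= b)%N by rewrite -ltnS.
    have is' : (i <= s)%N by rewrite -ltnS.
    have := @VM c (b - j)%N (s - i)%N j i; rewrite !subnK //; apply.
    by apply: idl_mulI => //; apply: ArB.
- by move=> c p [Ap Vp]; split=> // b s; apply: VS.
exists c => t s x Ux.
(* The monomial with coefficient x lies in the ideal of index c + t, hence in that of index c, whose
   component in bidegree (c + t, s) is m^t U c s. *)
have [||_ /(_ (c + t)%N s)] := hc (c + t)%N _ (bimon (c + t) s x); first exact: leq_addr.
- split=> [|b' s']; first by apply: Amon; apply: Usub.
  rewrite bimon_coef; case: ifP => [/andP[/eqP-> /eqP->]|_]; last exact: idl0.
  by rewrite /V subnn minnn idl_mul1l.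
by rewrite bimon_coef !eqxx /V addKn (minn_idPr (leq_addr _ _)).
Qed.

End ArtinRees.

(** * Growth of the fiber cone modulo a prime *)

Section FiberConeGrowth.
Variables (R : comRingType) (m I : R -> Prop).
Hypotheses (hm : is_ideal m) (hI : is_ideal I).
Implicit Types (p q g : {poly R}) (P : {poly R} -> Prop).

Definition rees p := forall n, idl_pow I n p`_n.
Definition rees_le n p := rees p /\ (size p <= n)%N.

(** Primes of the fiber cone as their preimages in the Rees algebra R[I t], so that polynomials
    replace sequences modulo an equivalence. *)
Definition rees_prime P := [/\
  (subsetP' P rees /\ forall p q, P p -> P q -> P (p + q)),
  forall p q, rees p -> P q -> P (p * q),
  ~ P 1, forall p q, rees p -> rees q -> P (p * q) -> P p \/ P q &
  forall p, (forall n, idl_mul m (idl_pow I n) p`_n) -> P p].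

Lemma rees0 : rees 0.
Proof. by move=> n; rewrite coef0; apply: idl0; apply: idl_pow_ideal. Qed.
Lemma reesD p q : rees p -> rees q -> rees (p + q).
Proof. by move=> hp hq n; rewrite coefD; apply: idlD => //; apply: idl_pow_ideal. Qed.
Lemma reesZ a p : rees p -> rees (a *: p).
Proof. by move=> hp n; rewrite coefZ; apply: idlM => //; apply: idl_pow_ideal. Qed.
Lemma reesM p q : rees p -> rees q -> rees (p * q).
Proof.
move=> hp hq n; rewrite coefM; apply: idl_sum => [|i _]; first exact: idl_pow_ideal.
have is' : (i <= n)%N by rewrite -ltnS.
by have := idl_powDI hI (hp i) (hq (n - i)%N); rewrite subnKC.
Qed.
Lemma reesXn n x : idl_pow I n x -> rees (x *: 'X^n).
Proof.
move=> hx k; rewrite coefZ coefXn; case: eqP => [->|_]; first by rewrite mulr1.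
by rewrite mulr0; apply: idl0; apply: idl_pow_ideal.
Qed.
Lemma reesC x : rees x%:P.
Proof. by rewrite -[x%:P]mulr1 mul_polyC; apply: (@reesXn 0). Qed.

Lemma rees_le_submod n : submod (rees_le n).
Proof.
split; first by split; [apply: rees0 | rewrite size_poly0].
split=> [p q [hp sp] [hq sq]|a p [hp sp]]; split.
- exact: reesD.
- by rewrite (leq_trans (size_polyD p q)) // geq_max sp.
- exact: reesZ.
- exact: leq_trans (size_scale_leq _ _) sp.
Qed.

Lemma rees_prime_submod P : rees_prime P -> submod P.
Proof.
move=> [[_ PD] PM _ _ P0]; split; last split=> // [a p Pp].
  by apply: P0 => n; rewrite coef0; apply: idl_mul0.
by rewrite -mul_polyC; apply: PM => //; apply: reesC.
Qed.

Lemma fc_elem_rees p : rees p -> fc_elem I (fun n => p`_n).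
Proof. by split=> //; exists (size p) => n; apply: nth_default. Qed.

Lemma rees_fc_elem a : fc_elem I a -> exists2 p, rees p & a = (fun n => p`_n).
Proof.
case=> [[N aN] aI]; have defa n : a n = (\poly_(i < N) a i)`_n.
  by rewrite coef_poly; case: ltnP => // /aN.
exists (\poly_(i < N) a i) => [n|]; first by rewrite -defa.
exact: functional_extensionality.
Qed.

Lemma fc_prime_rees C : fc_prime m I C -> rees_prime (fun p => C (fun n => p`_n)).
Proof.
have hext (a b : nat -> R) : a =1 b -> a = b by apply: functional_extensionality.
have defM p q : (fun n => (p * q)`_n) = fc_mul (fun n => p`_n) (fun n => q`_n).
  by apply: hext => n; rewrite coefM.
move=> [CI [C0 [_ [CD [CM [C1 Cp]]]]]]; split.
- split=> [p /CI[] //|p q Cp' Cq].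
  have -> : (fun n => (p + q)`_n) = fc_add (fun n => p`_n) (fun n => q`_n).
    by apply: hext => n; rewrite coefD.
  exact: CD.
- by move=> p q hp Cq; rewrite defM; apply: CM => //; apply: fc_elem_rees.
- by have -> : (fun n => (1 : {poly R})`_n) = @fc_one R by apply: hext => n; rewrite coef1.
- by move=> p q hp hq; rewrite defM; apply: Cp; apply: fc_elem_rees.
- move=> p hp; apply: C0 => [|n]; last by rewrite /fc_zero subr0.
  by apply: fc_elem_rees => n; apply: (idl_mul_subr (idl_pow_ideal n hI) (hp n)).
Qed.

Lemma fc_chain_rees k c : prime_chain (fc_prime m I) k c ->
  prime_chain rees_prime k (fun i p => c i (fun n => p`_n)).
Proof.
move=> [c1 c2]; split=> [i ik|i ik]; first by apply: fc_prime_rees; apply: c1.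
have [sub [a [ca na]]] := c2 i ik; split=> [p|]; first exact: sub.
have [ce _] := c1 _ ik; have [p _ defa] := rees_fc_elem (ce _ ca).
by exists p; rewrite -defa.
Qed.

Notation residue_chain P n h := (chain (fun p => P p /\ rees_le n p) (rees_le n) h).

(* If [P < P'] are primes and [g] lies in [P'] but not in [P], multiplication by [g]
   embeds the quotient by [P] into [P'/P]. *)
Lemma residue_chain_step P P' g n h h' :
  rees_prime P -> rees_prime P' -> subsetP' P P' -> P' g -> ~ P g ->
  residue_chain P n h -> residue_chain P' (n + size g) h' ->
  residue_chain P (n + size g) (h + h').
Proof.
move=> hP hP' PP' P'g nPg ch; apply: chain_cat; move: ch.
have hlin : linear (fun p : {poly R} => g * p).
  by move=> b u v; rewrite mulrDr scalerAr.
pose f : {linear {poly R} -> {poly R}} := HB.pack (fun p => g * p)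
  (GRing.isLinear.Build R {poly R} {poly R} *:%R _ hlin).
have [[PI _] _ _ Pp _] := hP; have [[P'I P'D] P'M _ _ _] := hP'.
have sP := rees_prime_submod hP; have sP' := rees_prime_submod hP'.
have sn := rees_le_submod n; have sne := rees_le_submod (n + size g).
apply: (chain_image (h := f)) => //.
- exact: submodI.
- exact: submodI.
- by move=> p [Pp' ?]; split=> //; apply: PP'.
- move=> p [hp sp]; split; first by rewrite /= mulrC; apply: P'M.
  split; first by apply: reesM => //; apply: P'I.
  by rewrite (leq_trans (size_polyMleq _ _)) // (leq_trans (leq_pred _)) // addnC leq_add2r.
- move=> p [hp sp] [Pgp _]; split=> //.
  by case: (Pp g p) => //; apply: P'I.
Qed.

(** With e the size of some g in c 1 outside c 0, each multiplication by g raises degrees by less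
    than e and adds a chain for c 1, of length about n^k. About n/(2e) such multiplications fit. *)
Lemma residue_chain_growth k c : prime_chain rees_prime k c ->
  exists2 D, (0 < D)%N & forall n, exists2 h, residue_chain (c 0%N) n.+1 h &
    (n ^ k <= D * h)%N.
Proof.
elim: k c => [|k IH] c [c1 c2].
  exists 1%N => // n; exists 1%N => //=.
  have hc := c1 0%N isT; have [_ _ nc1 _ _] := hc.
  exists (fun p => c 0%N p /\ rees_le n.+1 p); split=> //.
    by apply: submodI; [apply: rees_prime_submod | apply: rees_le_submod].
  split=> [p []|] //; exists 1; split; last by case.
  by split; [apply: (reesC 1) | rewrite size_poly1].
have [|D D0 hD] := IH (fun i => c i.+1); first by split=> i ik; [apply: c1 | apply: c2].
have hc0 := c1 0%N isT; have hc1 := c1 1%N isT.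
have [c01 [g [c1g nc0g]]] := c2 0%N isT.
have e0 : (0 < size g)%N.
  rewrite lt0n size_poly_eq0; apply/eqP => g0; apply: nc0g; rewrite g0.
  by case: (rees_prime_submod hc0).
set e := size g in e0.
(* After t multiplications, t + 1 chains for c 1 have been collected, all in degree bounds at least
   u. *)
have iter t u n : (u + t * e <= n)%N ->
    exists2 h, residue_chain (c 0%N) n.+1 h & (t.+1 * u ^ k <= D * h)%N.
  elim: t n => [|t IHt] n un.
    have [h ch hh] := hD n; exists h.
      by apply: chain_le ch => // p [c0p ?]; split=> //; apply: c01.
    by rewrite mul1n (leq_trans _ hh) // leq_expl // (leq_trans _ un) // leq_addr.
  have [h ch hh] := IHt (n - e)%N ltac:(lia).
  have [h' ch' hh'] := hD n; exists (h + h')%N.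
    have en : ((n - e).+1 + size g = n.+1)%N by rewrite -/e; lia.
    have := @residue_chain_step (c 0%N) (c 1%N) g (n - e).+1 h h' hc0 hc1 c01 c1g nc0g.
    by rewrite en; apply.
  have : (u ^ k <= n ^ k)%N by apply: leq_expl; lia.
  rewrite mulnDr [(t.+2 * _)%N]mulSn; lia.
(* With t = n/(2e) rounded down, n is less than (t + 1) 2e and at most 2u; these two estimates give
   the factors 2e and 2^k. *)
exists (2 * e * 2 ^ k * D)%N; first by rewrite !muln_gt0 e0 D0 expn_gt0.
move=> n; pose t := (n %/ (2 * e))%N; pose u := (n - t * e)%N.
have te : (t * (2 * e) <= n)%N by apply: leq_trunc_div.
have te1 : (n < t.+1 * (2 * e))%N by rewrite -ltn_divLR // muln_gt0 e0.
have [|h ch hh] := iter t u n; first by rewrite /u; lia.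
exists h => //; rewrite expnS -!mulnA.
have nu : (n <= 2 * u)%N by rewrite /u; lia.
have nuk : (n ^ k <= 2 ^ k * u ^ k)%N by rewrite -expnMn; apply: leq_expl.
apply: (@leq_trans (t.+1 * (2 * e) * (2 ^ k * u ^ k))); first by apply: leq_mul; rewrite // ltnW.
have -> : (t.+1 * (2 * e) * (2 ^ k * u ^ k) = 2 * (e * (2 ^ k * (t.+1 * u ^ k))))%N by ring.
by rewrite !leq_mul2l hh !orbT.
Qed.

End FiberConeGrowth.

(** * Passage to a homogeneous prime and to lengths in single degrees *)

Section HomogeneousPrime.
Variables (R : comRingType) (m I : R -> Prop).
Hypotheses (hm : is_ideal m) (hI : is_ideal I).

(* [Q s] is the degree [s] part of a homogeneous prime of the fiber cone, pulled back
   to [I^s]. *)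
Definition fiber_prime (Q : nat -> R -> Prop) := [/\
  forall s, is_ideal (Q s) /\ subsetP' (Q s) (idl_pow I s),
  forall s, subsetP' (idl_mul m (idl_pow I s)) (Q s),
  ~ Q 0%N 1 &
  forall s u x y, idl_pow I s x -> idl_pow I u y -> Q (s + u)%N (x * y) ->
    Q s x \/ Q u y].

Definition fiber_growth (Q : nat -> R -> Prop) d := exists2 D, (0 < D)%N &
  forall n, exists H : nat -> nat,
    (forall s, (s <= n)%N -> idl_chain (Q s) (idl_pow I s) (H s)) /\
    (n ^ d <= D * \sum_(s < n.+1) H s)%N.

(** The largest homogeneous ideal inside P, degree by degree. Shrinking P to it can only enlarge the
    quotient, so the growth is kept. *)
Definition homog_part (P : {poly R} -> Prop) s x := idl_pow I s x /\ P (x *: 'X^s).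

Lemma homog_part_prime P : rees_prime m I P -> fiber_prime (homog_part P).
Proof.
move=> hP; have [P0 [PD PZ]] := rees_prime_submod hI hP; have [_ _ P1 Pp Pm] := hP.
have hIs s : is_ideal (idl_pow I s) by exact: idl_pow_ideal.
split.
- move=> s; split; last by move=> x [].
  split; first by split; [apply: idl0 | rewrite scale0r].
  split=> [x y [Ix Px] [Iy Py]|a x [Ix Px]]; split.
  + exact: idlD.
  + by rewrite scalerDl; apply: PD.
  + exact: idlM.
  + by rewrite -scalerA; apply: PZ.
- move=> s x hx; split; first exact: idl_mul_subr hx.
  apply: Pm => n; rewrite coefZ coefXn; case: eqP => [->|_]; first by rewrite mulr1.
  by rewrite mulr0; apply: idl_mul0.
- by case=> _; rewrite expr0 scale1r.
- move=> s u x y Ix Iy [_]; rewrite exprD -scalerA => Pxy.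
  have [||] := Pp (x *: 'X^s) (y *: 'X^u) (reesXn hI Ix) (reesXn hI Iy).
  + by rewrite -scalerAl -scalerAr.
  + by left.
  + by right.
Qed.

Lemma homog_chain P n k : rees_prime m I P ->
  chain (fun p => P p /\ rees_le I n p) (rees_le I n) k ->
  exists H : nat -> nat,
    (forall s, (s < n)%N -> idl_chain (homog_part P s) (idl_pow I s) (H s)) /\
    (k <= \sum_(s < n) H s)%N.
Proof.
move=> hP; have [hQ _ _ _] := homog_part_prime hP.
have hQid s : is_ideal (homog_part P s) by case: (hQ s).
have hIs s : is_ideal (idl_pow I s) by exact: idl_pow_ideal.
have [P0 [PD PZ]] := rees_prime_submod hI hP.
pose B n p := rees_le I n p /\ forall s, homog_part P s p`_s.
have hB l : submod (B l).
  have [r0 [rD rZ]] := rees_le_submod hI l; split.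
    by split=> // s; rewrite coef0; apply: idl0.
  split=> [p q [rp Bp] [rq Bq]|a p [rp Bp]]; split; try by auto.
    by move=> s; rewrite coefD; apply: idlD.
  by move=> s; rewrite coefZ; apply: idlM.
have BP p l : B l p -> P p.
  case=> _ Bp; rewrite -[p]coefK poly_def; apply: (big_ind P) => // i _.
  by case: (Bp i).
move=> ch; have {ch} : chain (B n) (rees_le I n) k.
  by apply: chain_le ch => // p Bp; split; [apply: BP Bp | case: Bp].
elim: n k => [|n IH] k.
  case: k => [|k] ch; first by exists (fun _ => 0%N); rewrite big_ord0.
  case: ch => K [_ /chain_sub BK [_ [p [[_ sp] nKp]]]]; case: nKp; apply: BK.
  move: sp; rewrite leqn0 size_poly_eq0 => /eqP->; by case: (hB 0%N).
(* M separates the top degree: the coefficient in degree n embeds everything modulo M, and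
   truncation embeds M modulo [B n.+1] into the lower degrees. *)
pose M p := rees_le I n.+1 p /\ homog_part P n p`_n.
have hM : submod M.
  have [r0 [rD rZ]] := rees_le_submod hI n.+1; split.
    by split=> //; rewrite coef0; apply: idl0.
  split=> [p q [rp Bp] [rq Bq]|a p [rp Bp]]; split; try by auto.
    by rewrite coefD; apply: idlD.
  by rewrite coefZ; apply: idlM.
have BM : subsetP' (B n.+1) M by move=> p [rp Bp].
have MR : subsetP' M (rees_le I n.+1) by move=> p [].
move=> /(chain_split (hB _) hM (rees_le_submod hI _) BM MR)[k1 [k2 [-> c1 c2]]].
have {}c2 : idl_chain (homog_part P n) (idl_pow I n) k2.
  apply: (chain_image (h := coefp n) (V' := R^o)) c2 => //.
  - exact: rees_le_submod.
  - exact: hQid.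
  - exact: hIs.
  - by case: (hQ n).
  - by move=> p [rp _]; apply: rp.
have {}c1 : chain (B n) (rees_le I n) k1.
  apply: (chain_image (h := take_poly n)) c1 => //.
  - exact: rees_le_submod.
  - by move=> p [].
  - move=> p [[rp _] _]; split; last exact: size_take_poly.
    by move=> s; rewrite coef_take_poly; case: ifP => // _; apply: idl0.
  - move=> p [[rp sp] Bp] [_ Bt]; split=> // s; have := Bt s.
    rewrite coef_take_poly; case: ltnP => // ns _.
    move: ns; rewrite leq_eqVlt => /orP[/eqP<-|ns] //.
    by rewrite nth_default ?(leq_trans sp) //; apply: idl0.
have [H [H1 H2]] := IH _ c1.
exists (fun s => if s == n then k2 else H s); split.
  move=> s; rewrite ltnS leq_eqVlt => /orP[/eqP->|sn]; first by rewrite eqxx.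
  by rewrite (ltn_eqF sn); apply: H1.
rewrite big_ord_recr /= eqxx leq_add2r (leq_trans H2) // leq_sum // => i _.
by rewrite (ltn_eqF (ltn_ord i)).
Qed.

Lemma analytic_spread_growth d : analytic_spread_eq m I d ->
  exists2 Q, fiber_prime Q & fiber_growth Q d.
Proof.
case=> [[c /(fc_chain_rees hI) hc] _].
have hc0 : rees_prime m I (fun p => c 0%N (fun n => p`_n)) by case: hc => /(_ 0%N isT).
exists (homog_part (fun p => c 0%N (fun n => p`_n))); first exact: homog_part_prime.
have [D D0 hD] := residue_chain_growth hI hc; exists D => // n.
have [h ch nh] := hD n; have [H [H1 H2]] := homog_chain hc0 ch.
by exists H; split=> //; rewrite (leq_trans nh) // leq_mul2l H2 orbT.
Qed.

End HomogeneousPrime.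

(** * The two cases *)

Section Cases.
Variables (R : comRingType) (m I : R -> Prop) (Q : nat -> R -> Prop).
Hypotheses (hnoeth : noetherian R) (hm : is_ideal m) (hI : is_ideal I).
Hypotheses (Im : subsetP' I m) (hQ : fiber_prime m I Q).

Let hIs s : is_ideal (idl_pow I s). Proof. exact: idl_pow_ideal. Qed.
Let hms s : is_ideal (idl_pow m s). Proof. exact: idl_pow_ideal. Qed.
Let hQs s : is_ideal (Q s). Proof. by case: hQ => /(_ s)[]. Qed.
Let mQ s : subsetP' (idl_mul m (idl_pow I s)) (Q s). Proof. by case: hQ. Qed.

Lemma powS_fiber s : subsetP' (idl_pow I s.+1) (Q s).
Proof. by move=> x hx; apply: mQ; rewrite idl_mulC; apply: idl_mulS hx. Qed.

Lemma fiber_primeM s u x y : idl_pow I s x -> idl_pow I u y -> ~ Q s x -> ~ Q u y ->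
  ~ Q (s + u)%N (x * y).
Proof. by move=> Ix Iy nx ny; case: hQ => _ _ _ Qp /Qp[]. Qed.

Lemma fiber_primeX s x j : idl_pow I s x -> ~ Q s x -> ~ Q (s * j)%N (x ^+ j).
Proof.
move=> Ix nx; elim: j => [|j IH]; first by rewrite muln0; case: hQ.
by rewrite mulnS exprS; apply: fiber_primeM => //; apply: idl_powX.
Qed.

(** In the associated graded ring: either some class outside Q is killed by a power of m, or for one
    f in m all f-power torsion lies in Q. *)
Lemma fiber_dichotomy :
  (exists e z k, [/\ idl_pow I e z, ~ Q e z &
     forall y, idl_pow m k y -> idl_pow I e.+1 (z * y)]) \/
  (exists2 f, m f & forall s z k, idl_pow I s z -> idl_pow I s.+1 (f ^+ k * z) -> Q s z).
Proof.
have [|nB] := classic (exists2 f, m f & forall s z k,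
  idl_pow I s z -> idl_pow I s.+1 (f ^+ k * z) -> Q s z); [by right | left].
have bad f : m f -> exists s z k,
    [/\ idl_pow I s z, idl_pow I s.+1 (f ^+ k * z) & ~ Q s z].
  move=> mf; apply: NNPP => nf; apply: nB; exists f => // s z k Iz Ifz.
  by apply: NNPP => nQ; apply: nf; exists s, z, k.
have [fs defm] := noetherian_fg hnoeth hm.
have zid := idl_zero_ideal R.
have mfs f : f \in fs -> m f by rewrite defm; apply: idl_gen_mem.
(* A suitable z is built for the ideal generated by an initial set of generators; for the zero ideal
   z = 1 works. *)
rewrite defm; elim: fs {defm} mfs => [|f fs IH] mfs.
  exists 0%N, 1, 1%N; split=> //; first by case: hQ.
  by move=> y; rewrite [idl_pow _ _]idl_pow1 // => ->; rewrite mulr0; apply: idl0.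
have [|e1 [z1 [k1 [I1 n1 h1]]]] := IH.
  by move=> g gfs; apply: mfs; rewrite inE gfs orbT.
have [|e2 [z2 [k2 [I2 h2 n2]]]] := bad f; first by apply: mfs; rewrite inE eqxx.
exists (e1 + e2)%N, (z1 * z2), (k1 + k2)%N; split.
- exact: idl_powDI.
- exact: fiber_primeM.
move=> y /(idl_pow_adj (idl_gen_ideal fs zid))[u [_ [/h1 hu [v _ ->] ->]]].
have -> : z1 * z2 * (u + f ^+ k2 * v) = (z1 * u) * z2 + v * (z1 * (f ^+ k2 * z2)) by ring.
apply: idlD => //; first by rewrite -addSn; apply: idl_powDI.
by apply: idlM => //; rewrite -addnS; apply: idl_powDI.
Qed.

(** * First case: a torsion class outside Q *)

Section TorsionCase.
Variables (e : nat) (z : R) (k : nat).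
Hypotheses (Iz : idl_pow I e z) (nQz : ~ Q e z).
Hypothesis hz : forall y, idl_pow m k y -> idl_pow I e.+1 (z * y).

Lemma torsion_pow j y : idl_pow m (k * j) y -> idl_pow I (e.+1 * j) (z ^+ j * y).
Proof.
elim: j y => [|j IH] y; first by rewrite !muln0.
rewrite !mulnS idl_powD // exprS.
apply: (idl_mul_sub (L := fun y => idl_pow I (e.+1 + e.+1 * j) (z * z ^+ j * y))) y.
  split; first by rewrite mulr0; apply: idl0.
  split=> [u v hu hv|a u hu]; first by rewrite mulrDr; apply: idlD.
  by rewrite mulrCA; apply: idlM.
by move=> u v /hz hu /IH hv; rewrite mulrACA; apply: idl_powDI.
Qed.

(** The saturation of I^n is filtered by its intersections with I^s, for s from n down to n - J; z^j
    contributes the layer from s = n - j + 1 to s = n - j. *)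
Lemma torsion_chain n J (H : nat -> nat) : (e.+1 * J <= n)%N ->
  (forall s, (s + e.+1 <= n)%N -> idl_chain (Q s) (idl_pow I s) (H s)) ->
  idl_chain (idl_pow I n) (idl_sat m (idl_pow I n)) (\sum_(j < J) H (n - e.+1 * j.+1)%N).
Proof.
move=> hJ hH; pose Y s x := idl_sat m (idl_pow I n) x /\ idl_pow I s x.
have hY s : is_ideal (Y s) by apply: idlI => //; apply: idl_sat_ideal.
suff : idl_chain (idl_pow I n) (Y (n - J)%N) (\sum_(j < J) H (n - e.+1 * j.+1)%N).
  by apply: chain_le => // x [].
elim: J hJ => [|J IH] hJ.
  rewrite big_ord0 subn0 => x Ix; split=> //.
  by exists 0%N => y _; apply: idlMr.
rewrite big_ord_recr /=; apply: chain_cat; first by apply: IH; nia.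
have [b defn] : exists b, n = (e.+1 * J.+1 + b)%N by exists (n - e.+1 * J.+1)%N; lia.
have eb : (n - e.+1 * J.+1 = b)%N by rewrite defn addKn.
have enJ : (n - J.+1 = e * J.+1 + b)%N by rewrite defn mulSn; lia.
have enJ' : (n - J = (e * J.+1 + b).+1)%N by rewrite defn mulSn; lia.
apply: (idl_chain_mul (x := z ^+ J.+1) (N := idl_pow I b) (J := Q b)) => //.
- by rewrite enJ enJ' => x [sx Ix]; split=> //; apply: idl_pow_dec Ix.
- move=> x Ix; split.
    exists (k * J.+1)%N => y /torsion_pow hy.
    by rewrite defn mulrAC; apply: idl_powDI.
  by rewrite enJ; apply: idl_powDI => //; apply: idl_powX.
(* The product of x with the power of z has degree n - J - 1 and lies one power of I deeper, hence
   in Q; since z is outside the prime Q, x lies in Q. *)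
- move=> x Ix [_]; rewrite enJ' => /powS_fiber Qzx; apply: NNPP => nQx.
  by apply: fiber_primeM Qzx => //; [apply: idl_powX | apply: fiber_primeX].
- by rewrite eb; apply: hH; rewrite defn; nia.
Qed.

(* The residue classes modulo [e + 1] of the degrees occurring in [torsion_chain] for
   [e + 1] consecutive exponents together exhaust all degrees up to [n]. *)
Lemma residue_class_sum n (H : nat -> nat) :
  (\sum_(i < e.+1) \sum_(j < (n + i) %/ e.+1) H (n + i - e.+1 * j.+1) =
  \sum_(s < n) H s)%N.
Proof.
pose S l := (\sum_(j < l %/ e.+1) H (l - e.+1 * j.+1))%N.
rewrite -[LHS]/(\sum_(i < e.+1) S (n + i))%N.
have SE l : S (l + e.+1)%N = (H l + S l)%N.
  rewrite /S divnDr // divnn /= addn1 big_ord_recl muln1 addnK; congr (_ + _)%N.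
  by apply: eq_bigr => j _; rewrite /bump /= [(e.+1 * (1 + j).+1)%N]mulnS subnDA addnK.
elim: n => [|n IH].
  rewrite big_ord0 big1 // => i _; rewrite /S add0n divn_small ?big_ord0 //.
rewrite [RHS]big_ord_recr -IH /=; apply/eqP; rewrite -(eqn_add2l (S n)).
have -> : (S n + \sum_(i < e.+1) S (n.+1 + i) = \sum_(i < e.+2) S (n + i))%N.
  by rewrite [RHS]big_ord_recl addn0; congr (_ + _)%N; apply: eq_bigr => i _; rewrite addSnnS.
rewrite big_ord_recr /= SE; apply/eqP.
by rewrite [RHS]addnCA [(S n + H n)%N]addnC.
Qed.

End TorsionCase.
End Cases.

Lemma torsion_case_absurd (R : comRingType) (m I : R -> Prop) Q d e z k C n0 :
  is_ideal m -> is_ideal I -> subsetP' I m -> fiber_prime m I Q -> fiber_growth I Q d ->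
  idl_pow I e z -> ~ Q e z -> (forall y, idl_pow m k y -> idl_pow I e.+1 (z * y)) ->
  ~ (forall n h, (n0 <= n)%N -> (0 < n)%N ->
       idl_chain (idl_pow I n) (idl_sat m (idl_pow I n)) h -> (h * n <= C * n ^ d)%N).
Proof.
move=> hm hI Im hQ [D D0 hD] Iz nQz hz hC.
(* The e + 1 exponents n + 1, ..., n + 1 + e are used; each is at most (e + 2) n because n is
   positive. *)
apply: (@expn_growth_absurd n0 (D * (e.+1 * C)) e.+2 d) => n n0n n1.
have [H [hH nH]] := hD n.
apply: (@leq_trans (n * (D * \sum_(s < n.+1) H s))); first by rewrite leq_mul2l nH orbT.
rewrite -(residue_class_sum e) mulnCA -mulnA leq_mul2l big_distrr /=.
apply/orP; right; apply: (@leq_trans (\sum_(i < e.+1) C * (e.+2 * n) ^ d)); last first.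
  by rewrite sum_nat_const card_ord mulnA.
apply: leq_sum => i _; set S := (\sum_(j < _) _)%N.
have ie := ltn_ord i.
have chS : idl_chain (idl_pow I (n.+1 + i)) (idl_sat m (idl_pow I (n.+1 + i))) S.
  apply: (torsion_chain hm hI Im hQ Iz nQz hz); first by rewrite mulnC leq_trunc_div.
  by move=> s hs; apply: hH; lia.
have hS : (S * (n.+1 + i) <= C * (n.+1 + i) ^ d)%N by apply: hC chS; lia.
apply: (@leq_trans (S * (n.+1 + i))); first by rewrite mulnC; apply: leq_mul => //; lia.
rewrite (leq_trans hS) // leq_mul2l; apply/orP; right; apply: leq_expl; nia.
Qed.

(** * Second case: all f-power torsion lies in Q *)

Section TorsionFreeCase.
Variables (R : comRingType) (m I : R -> Prop) (Q : nat -> R -> Prop) (f : R).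
Hypotheses (hnoeth : noetherian R) (hm : is_ideal m) (hI : is_ideal I).
Hypotheses (hQ : fiber_prime m I Q) (mf : m f).
Hypothesis hf : forall s z k,
  idl_pow I s z -> idl_pow I s.+1 (f ^+ k * z) -> Q s z.

Let hIs s : is_ideal (idl_pow I s). Proof. exact: idl_pow_ideal. Qed.
Let hms s : is_ideal (idl_pow m s). Proof. exact: idl_pow_ideal. Qed.
Let hQs s : is_ideal (Q s). Proof. by case: hQ => /(_ s)[]. Qed.
Let mQ s : subsetP' (idl_mul m (idl_pow I s)) (Q s). Proof. by case: hQ. Qed.
Let mI b s := idl_mul (idl_pow m b) (idl_pow I s).
Let hmI b s : is_ideal (mI b s). Proof. exact: mI_ideal. Qed.

(** The f-power torsion of the associated graded ring in degree s, pulled back to I^s. *)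
Definition ftorsion s x := idl_pow I s x /\ exists k, idl_pow I s.+1 (f ^+ k * x).

Lemma ftorsion_ideal s : is_ideal (ftorsion s).
Proof.
split; first by split; [apply: idl0 | exists 0%N; rewrite mulr0; apply: idl0].
split=> [x y [Ix [k hk]] [Iy [l hl]]|a x [Ix [k hk]]]; split.
- exact: idlD.
- exists (k + l)%N; rewrite mulrDr; apply: idlD => //.
    by rewrite exprD mulrAC; apply: idlMr.
  by rewrite exprD -mulrA; apply: idlM.
- exact: idlM.
- by exists k; rewrite mulrCA; apply: idlM.
Qed.

Lemma mI_mulm b s x y : m x -> mI b s y -> mI b.+1 s (x * y).
Proof.
move=> mx hy; rewrite mulrC /mI idl_mulC; rewrite /mI idl_mulC in hy.
by rewrite /= idl_mulA; apply: idl_mulI.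
Qed.

Lemma mI_mulI b s x y : I x -> mI b s y -> mI b s.+1 (x * y).
Proof. by move=> Ix hy; rewrite mulrC /mI /= idl_mulA; apply: idl_mulI. Qed.

Lemma artin_rees_pow : exists c, forall t s x,
  mI (c + t) s x -> idl_pow I s.+1 x -> mI t s.+1 x.
Proof.
have [||||c hc] := @artin_rees R m I hnoeth hm hI (fun b s x => mI b s x /\ idl_pow I s.+1 x).
- by move=> b s; apply: idlI.
- by move=> b s x [].
- by move=> b s x y mx [hy Iy]; split; [apply: mI_mulm | apply: idlM].
- move=> b s x y Ix [hy Iy]; split; first exact: mI_mulI.
  by rewrite mulrC; apply: idl_mulI.
exists c => t s x hx Ix.
by have := hc t s x (conj hx Ix); apply: idl_mulS => // y [].
Qed.

(** Modulo its f-power torsion, the associated graded ring has f as a nonzerodivisor. Artin-Rees for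
    torsion plus multiples of f then allows division by f at a fixed loss in the power of m. *)
Lemma artin_rees_torsion : exists c, forall t s x, idl_pow I s x ->
  idl_add (ftorsion s) (mI (c + t) s) (f * x) -> idl_add (ftorsion s) (mI t s) x.
Proof.
pose W s := idl_add (ftorsion s) (idl_scale f (idl_pow I s)).
have hW s : is_ideal (W s).
  by apply: idl_add_ideal; [apply: ftorsion_ideal | apply: idl_scale_ideal].
have [||||c hc] := @artin_rees R m I hnoeth hm hI (fun b s x => mI b s x /\ W s x).
- by move=> b s; apply: idlI.
- by move=> b s x [].
- by move=> b s x y mx [hy Wy]; split; [apply: mI_mulm | apply: (idlM x (hW s))].
- move=> b s x y Ix [hy Wy]; split; first exact: mI_mulI.
  case: Wy => u [_ [[Iu [k hk]] [v Iv ->] ->]].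
  exists (u * x), (f * (v * x)); split; last by ring.
    split; first exact: idl_mulI.
    by exists k; rewrite mulrA; apply: idl_mulI.
  by exists (v * x) => //; apply: idl_mulI.
exists c => t s x Ix [u [v [tu hv fx]]].
have hft := ftorsion_ideal s.
have Wv : W s v.
  exists (- u), (f * x); split; [exact: idlN | by exists x | by rewrite fx addKr].
(* This y approximates x: f (x - y) is torsion, hence so is x - y. *)
have {hc} [w [y [tw hy ev]]] : exists w y, [/\ ftorsion s w, mI t s y & v = w + f * y].
  have := hc t s v (conj hv Wv).
  pose L v := exists w y, [/\ ftorsion s w, mI t s y & v = w + f * y].
  apply: (idl_mul_min (L := L)).
  - by exists 0, 0; rewrite mulr0 addr0; split=> //; apply: idl0.
  - move=> _ _ [w [y [tw hy ->]]] [w' [y' [tw' hy' ->]]].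
    by exists (w + w'), (y + y'); split; [apply: idlD | apply: idlD | ring].
  - move=> a _ ma [_ [w [_ [tw [y Iy ->] ->]]]].
    by exists (a * w), (a * y); split; [apply: idlM | apply: idl_mulI | ring].
have Iy : idl_pow I s y by apply: (idl_mul_subr (hIs s) hy).
exists (x - y), y; split=> //; last by rewrite subrK.
split; first exact: idlB.
have [_ [k hk]] : ftorsion s (f * (x - y)).
  have -> : f * (x - y) = u + w by rewrite mulrBr fx ev; ring.
  exact: idlD.
by exists k.+1; rewrite exprSr -mulrA.
Qed.

(** Moving from m^N into I^s costs c1 for each power of I, and cancelling f^a costs c2 for each
    factor f. The strict bound leaves at least one factor from m, and m I^s lies in Q. *)
Lemma torsionfree_separation : exists c1 c2, forall N s a x,
  (c1 * s + c2 * a < N)%N -> idl_pow I s x ->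
  idl_add (idl_pow I s.+1) (idl_pow m N) (f ^+ a * x) -> Q s x.
Proof.
have [c1 h1] := artin_rees_pow; have [c2 h2] := artin_rees_torsion.
exists c1, c2 => N s a x hN Ix [u [v [Iu mv fx]]].
have [t eN] : exists t, N = (c1 * s + (c2 * a + t.+1))%N.
  by exists (N - (c1 * s + c2 * a)).-1; lia.
have Iv : idl_pow I s v.
  have -> : v = f ^+ a * x - u by rewrite fx addrC addKr.
  by apply: idlB; rewrite //; [apply: idlM | apply: idl_pow_dec Iu].
(* [artin_rees_pow] is applied s times, starting from v in m^N and ending in a power of m times
   I^s. *)
have hv : mI (c2 * a + t.+1) s v.
  move: (c2 * a + t.+1)%N eN => M eN; rewrite {N hN}eN in mv.
  elim: s {x Ix u Iu fx} M mv Iv => [|s IH] M mv Iv.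
    by rewrite /mI idl_mulC idl_mul1l //; rewrite muln0 in mv.
  apply: h1 => //; apply: IH; first by rewrite addnA -mulnSr.
  exact: idl_pow_dec Iv.
have : idl_add (ftorsion s) (mI (c2 * a + t.+1) s) (f ^+ a * x).
  by exists u, v; split=> //; split; [apply: idl_pow_dec Iu | exists 0%N; rewrite mul1r].
move: {fx hv} (t.+1) (ltn0Sn t) => T T0.
elim: a {hN eN} x Ix => [|a IH] x Ix.
  rewrite muln0 mul1r => -[w [y [[Iw [k hk]] hy ->]]]; apply: idlD => //; first exact: hf hk.
  apply: mQ; apply: idl_mulS hy => //; rewrite -{2}(idl_pow1 hm); exact: idl_pow_dec.
rewrite mulnS -addnA exprS -mulrA => hx; apply: IH => //.
by apply: h2 hx; apply: idlM.
Qed.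

(** For every s <= n, the step from I^(s+1) + m^N to I^s + m^N is refined by powers of f into n
    layers, each at least as long as the chain for I^s/Q_s. *)
Lemma torsionfree_chain : exists c, forall n (H : nat -> nat),
  (forall s, (s <= n)%N -> idl_chain (Q s) (idl_pow I s) (H s)) ->
  idl_chain (idl_pow m (c * n).+1) (fun _ => True) (n * \sum_(s < n.+1) H s).
Proof.
have [c1 [c2 hsep]] := torsionfree_separation; exists (c1 + c2)%N => n H hH.
set N := ((c1 + c2) * n).+1.
pose Z s a := idl_add (idl_scale (f ^+ a) (idl_pow I s)) (idl_add (idl_pow I s.+1) (idl_pow m N)).
have hIN s : is_ideal (idl_add (idl_pow I s) (idl_pow m N)) by apply: idl_add_ideal.
have hZ s a : is_ideal (Z s a) by apply: idl_add_ideal => //; apply: idl_scale_ideal.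
have ZS s a : (s <= n)%N -> (a <= n)%N -> idl_chain (Z s a.+1) (Z s a) (H s).
  move=> sn an; apply: (idl_chain_mul (x := f ^+ a) _ _ _ _ _ _ (hH s sn)) => //.
  - apply: idl_add_sub => //; last by apply: idl_addr; apply: idl_scale_ideal.
    move=> _ [y Iy ->]; apply: idl_addl => //; exists (f * y); first exact: idlM.
    by rewrite exprSr mulrA.
  - by move=> x Ix; apply: idl_addl => //; exists x.
  (* Separation is applied to x - f w, whose product with f^a lies in I^(s+1) + m^N; the term f w is
     in m I^s, hence in Q. *)
  - move=> x Ix [_ [v [[w Iw ->] hv fx]]].
    have mw : Q s (f * w) by apply: mQ; apply: idl_mulI.
    rewrite -[x](subrK (f * w)); apply: idlD => //; apply: (hsep N _ a).
    + by rewrite /N ltnS mulnDl leq_add // leq_mul2l ?sn ?an orbT.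
    + by apply: idlB => //; apply: idlM.
    + by rewrite mulrBr mulrA -exprSr fx addrAC subrr add0r.
have Zn s a : (s <= n)%N -> (a <= n)%N -> idl_chain (Z s a) (Z s 0%N) (a * H s).
  move=> sn; elim: a => [|a IH] an; first by rewrite mul0n.
  by rewrite mulSn; apply: chain_cat (IH (ltnW an)); apply: ZS => //; apply: ltnW.
suff main s : (s <= n.+1)%N ->
    idl_chain (idl_add (idl_pow I s) (idl_pow m N)) (fun _ => True) (n * \sum_(i < s) H i).
  by apply: chain_le (main n.+1 (leqnn _)) => //; exact: (idl_addr (hIs _)).
elim: s => [|s IH] sn; first by rewrite big_ord0 muln0.
rewrite big_ord_recr mulnDr [X in idl_chain _ _ X]addnC; apply: chain_cat (IH (ltnW sn)).
apply: chain_le (Zn s n sn (leqnn _)); first exact: (idl_addr (idl_scale_ideal _ (hIs s))).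
apply: (idl_add_sub (hIN s)).
  by move=> _ [y Iy ->]; apply: idl_addl => //; apply: idlM.
apply: (idl_add_sub (hIN s)); last exact: (idl_addr (hIs s)).
by move=> y Iy; apply: idl_addl => //; apply: idl_pow_dec Iy.
Qed.

Lemma torsionfree_case_absurd d :
  is_local m -> dim_eq R d -> fiber_growth I Q d -> False.
Proof.
move=> hloc hdim [D D0 hD]; have [C hC] := length_leq_dim hnoeth hloc hdim.
have [c hc] := torsionfree_chain.
(* For positive n, the exponent c n + 1 is at most (c + 1) n. *)
apply: (@expn_growth_absurd 0 (D * C) c.+1 d) => n _ n1.
have [H [hH nH]] := hD n; have := hC _ _ (hc n H hH) => hN.
apply: (@leq_trans (n * (D * \sum_(s < n.+1) H s))); first by rewrite leq_mul2l nH orbT.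
rewrite mulnCA -mulnA leq_mul2l (leq_trans hN) ?orbT // leq_mul2l.
by apply/orP; right; apply: leq_expl; rewrite mulSn; lia.
Qed.

End TorsionFreeCase.

(** [msize] is one more than the degree, so F grows at most like n^(d-1); multiplying by n avoids a
    truncated exponent when d = 0. The constant comes from the sum of the absolute values of the
    coefficients. *)
Lemma meval_diag_bound r (F : {mpoly rat[r]}) d : (msize F <= d)%N ->
  exists C : nat, forall n : nat, (0 < n)%N ->
    F.@[fun _ => n%:R] * n%:R <= (C * n ^ d)%:R.
Proof.
move=> Fd; pose B := \sum_(u <- msupp F) `|F@_u|.
exists (Num.bound B) => n n0; rewrite mevalE mulr_suml.
have n1 : 1 <= n%:R :> rat by rewrite ler1n.
apply: (@le_trans _ _ (B * n%:R ^+ d)); last first.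
  rewrite natrM natrX ler_wpM2r ?exprn_ge0 ?ler0n // ltW //.
  by apply: archi_boundP; apply: sumr_ge0 => u _; apply: normr_ge0.
rewrite /B mulr_suml [leLHS]big_seq_cond [leRHS]big_seq_cond.
apply: ler_sum => u /andP[uF _].
rewrite -mulrA; have -> : (\prod_(i < r) n%:R ^+ u i) * n%:R = n%:R ^+ (mdeg u).+1 :> rat.
  by rewrite exprSr mdegE -expr_sum.
apply: (@le_trans _ _ (`|F@_u| * n%:R ^+ (mdeg u).+1)).
  by rewrite ler_wpM2r ?exprn_ge0 ?ler0n // ler_norm.
rewrite ler_wpM2l ?normr_ge0 // ler_weXn2l //.
by apply: leq_trans Fd; apply: msize_mdeg_lt.
Qed.

Theorem theorem5p2 (R : comRingType) (m : R -> Prop) (d : nat)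
  (hnoeth : noetherian R) (hloc : is_local m) (hdim : dim_eq R d)
  (r : nat) (I : 'I_r -> R -> Prop) (hI : forall i, is_ideal (I i))
  (hproper : ~ idl_prod I 1)
  (hspread : analytic_spread_eq m (idl_prod I) d)
  (F : {mpoly rat[r]}) (hF : numerical_poly F)
  (hbound : exists N : nat, forall n : 'I_r -> nat, (forall i, (N <= n i)%N) ->
     let J := idl_prod (fun i => idl_pow (I i) (n i)) in
     length_le J (idl_sat m J) F.@[fun i => (n i)%:R]) :
  (d < msize F)%N.
Proof.
have hP : is_ideal (idl_prod I) := idl_prod_ideal I.
have hm : is_ideal m by case: hloc => -[].
(* Properness of the product enters here: a proper ideal of a local ring lies in m. *)
have Pm : subsetP' (idl_prod I) m by case: hloc => _; apply.
rewrite ltnNge; apply/negP => /meval_diag_bound[C hC].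
have [Q hQ gQ] := analytic_spread_growth hP hspread.
have [[e [z [k [Iz nQz hz]]]]|[f mf hf]] := fiber_dichotomy hnoeth hm hP hQ.
  have [N hN] := hbound.
  apply: (@torsion_case_absurd R m (idl_prod I) Q d e z k C N) => // n h Nn n0 ch.
  have := hN (fun _ => n) (fun _ => Nn); rewrite /= idl_pow_prod => hlen.
  have hPn := idl_pow_ideal n hP.
  have := length_le_chain hPn (idl_sat_ideal hm hPn) hlen ch => hF'.
  rewrite -(ler_nat rat) natrM (le_trans _ (hC n n0)) //.
  by rewrite ler_wpM2r // ler0n.
exact: (torsionfree_case_absurd hnoeth hm hP hQ mf hf hloc hdim gQ).
Qed.
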